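(* For every integer $q>1$, \begin{align*} (1+(-1)^q)T_{1^2,q}&=\pi^2\zeta(q)+(-1)^q\widetilde{t}(q+2)+(1-(-1)^q)4\log(2)\widetilde{t}(q+1)-2\widetilde{t}(q+1,1)\\ &\quad+(1+(-1)^q)4\log^2(2)\widetilde{t}(q)-4\sum_{\substack{2k_1+k_2=q+1\\ k_1,k_2\geq 1}} \widetilde{t}(2k_1)\zeta(k_2+1)\\ &\quad-8\log(2)\sum_{\substack{2k_1+k_2=q\\ k_1,k_2\geq 1}} \widetilde{t}(2k_1)\zeta(k_2+1)+2\sum_{\substack{2k_1+k_2+k_3=q\\ k_1,k_2\geq1}} \widetilde{t}(2k_1)\zeta(k_2+1)\zeta(k_3+1). \end{align*}
   Context: Let $h_n=\sum_{k=1}^n (k-1/2)^{-1}$ for $n\ge0$ ($h_0=0$). For $q\ge2$, $T_{1^2,q}=\sum_{n=1}^\infty \frac{h_{n-1}^2}{(n-1/2)^q}$. For positive integers $s_1,\dots,s_k$ with $s_1>1$, $\widetilde{t}(s_1,\dots,s_k)=\sum_{n_1>\cdots>n_k\ge1}\prod_{j=1}^k (n_j-1/2)^{-s_j}$; in particular $\widetilde t(s)=(2^s-1)\zeta(s)$. $\zeta$ is the Riemann zeta function. In the last sum, $k_3$ ranges over positive integers. *)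

(* Defs.v *)
From Stdlib Require Export Reals List Arith.
From Coquelicot Require Export Coquelicot.
Export ListNotations.
Open Scope R_scope.

Definition half_int (n : nat) : R := INR n - 1 / 2.

(* [sum_n_m f 1 0] is the empty sum, so [h 0 = 0]. *)
Definition h (n : nat) : R := sum_n_m (fun k => / half_int k) 1 n.

(* In every [Series] below the summation index starts at 0, so the
   mathematical index is [S n]; here [h n] is h_{(S n) - 1}. *)
Definition T11 (q : nat) : R :=
  Series (fun n => h n ^ 2 / half_int (S n) ^ q).

Definition zeta (s : nat) : R := Series (fun n => / INR (S n) ^ s).

(* Sum over N > n_1 > ... > n_k >= 1 of prod_j (n_j - 1/2)^(-s_j);
   the range 1 .. N - 1 is empty when N <= 1. *)
Fixpoint t_below (s : list nat) (N : nat) : R :=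
  match s with
  | [] => 1
  | s1 :: s' => sum_n_m (fun n => / half_int n ^ s1 * t_below s' n) 1 (N - 1)
  end.

(* Sum over n_1 > ... > n_k >= 1, arranged by the value of n_1. *)
Definition ttilde (s : list nat) : R :=
  match s with
  | [] => 1
  | s1 :: s' => Series (fun n => / half_int (S n) ^ s1 * t_below s' (S n))
  end.

(* Sums of F over the positive integers satisfying [2 k_1 + k_2 = m],
   resp. [2 k_1 + k_2 + k_3 = m]; the constraint forces every k_i <= m. *)
Definition sum2 (m : nat) (F : nat -> nat -> R) : R :=
  sum_n_m (fun k1 => sum_n_m (fun k2 =>
    if (2 * k1 + k2 =? m)%nat then F k1 k2 else 0) 1 m) 1 m.

Definition sum3 (m : nat) (F : nat -> nat -> nat -> R) : R :=
  sum_n_m (fun k1 => sum_n_m (fun k2 => sum_n_m (fun k3 =>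
    if (2 * k1 + k2 + k3 =? m)%nat then F k1 k2 k3 else 0) 1 m) 1 m) 1 m.

(* Main.v *)
(* Contour-free version of the residue computation for the kernel
   pi tan(pi s) (psi(- s) + gamma)^2 / s^q.  Write P(s) = psi(- s) + gamma; at the half-integers
   a = n - 1/2 and - a its values are h_n - 2 log 2 and h_(n-1) - 2 log 2, so the symmetric sums
   of P(s) / s^q and P(s)^2 / s^q over all half-odd s are the left-hand sides to be computed.
   Peeling q terms off the partial fraction expansion of P gives
     P(s) / s^q = s^(-q-1) - sum_(0 < i < q) zeta(i+1) s^(i-q) - sum_k 1 / (k^q (k - s)).
   Multiplying by w = 1 or w = P and summing symmetrically over s, everything is expressed by
   lower sums except sum_k k^(-q) D_w(k), where D_w(k) is the symmetric sum of w(s) / (k - s).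
   Translation by 1, under which P(s) - P(s - 1) = 1 / s, shows that D_w(k) does not depend
   on k: it is 0 for w = 1 and - t(2) = - pi^2 / 2 for w = P.  The sums over s and k are
   exchanged by dominated convergence, with majorant C sqrt(k) / k^q. *)
From Stdlib Require Import Lra Lia.
Require Import Defs.

(* Coquelicot's generic sums produce equations in the carrier of a canonical structure, which
   [ring] and [field] do not recognise as equations in [R]. *)
Ltac eq_in_R := match goal with |- ?x = ?y => change (x = y :> R) end.

(** * Finite sums, series and dominated convergence over the reals *)

Lemma sum_n_Sr (u : nat -> R) (N : nat) :
  sum_n u (S N) = sum_n u N + u (S N) :> R.
Proof. exact (sum_Sn u N). Qed.

Lemma sum_n_0r (u : nat -> R) : sum_n u 0 = u 0%nat :> R.
Proof. exact (sum_O u). Qed.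

Lemma sum_n_Rplus (u v : nat -> R) (N : nat) :
  sum_n (fun n => u n + v n) N = sum_n u N + sum_n v N :> R.
Proof. exact (sum_n_plus u v N). Qed.

Lemma sum_n_Rscal (c : R) (u : nat -> R) (N : nat) :
  sum_n (fun n => c * u n) N = c * sum_n u N :> R.
Proof. exact (sum_n_mult_l c u N). Qed.

Lemma sum_n_Rle (u v : nat -> R) (N : nat) :
  (forall n, (n <= N)%nat -> u n <= v n) -> sum_n u N <= sum_n v N.
Proof.
  intros H; induction N as [|N IH].
  - rewrite !sum_n_0r; apply H; lia.
  - rewrite !sum_n_Sr.
    assert (sum_n u N <= sum_n v N) by (apply IH; intros n Hn; apply H; lia).
    specialize (H (S N) (Nat.le_refl _)); lra.
Qed.

Lemma sum_n_Rabs (u : nat -> R) (N : nat) :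
  Rabs (sum_n u N) <= sum_n (fun n => Rabs (u n)) N.
Proof.
  induction N as [|N IH].
  - rewrite !sum_n_0r; lra.
  - rewrite !sum_n_Sr.
    eapply Rle_trans; [apply Rabs_triang | lra].
Qed.

Lemma sum_n_shift (u : nat -> R) (N : nat) :
  sum_n u (S N) = u 0%nat + sum_n (fun n => u (S n)) N :> R.
Proof.
  induction N as [|N IH].
  - now rewrite sum_n_Sr, !sum_n_0r.
  - rewrite sum_n_Sr, IH, (sum_n_Sr (fun n => u (S n))); ring.
Qed.

Lemma sum_n_le_index (u : nat -> R) (N M : nat) :
  (forall n, 0 <= u n) -> (N <= M)%nat -> sum_n u N <= sum_n u M.
Proof.
  intros H HNM; induction HNM as [|M _ IH]; [lra|].
  rewrite sum_n_Sr; specialize (H (S M)); lra.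
Qed.

Lemma is_lim_sum_n (u : nat -> nat -> R) (l : nat -> R) (K : nat) :
  (forall k, is_lim_seq (fun N => u N k) (l k)) ->
  is_lim_seq (fun N => sum_n (u N) K) (sum_n l K).
Proof.
  intros H; induction K as [|K IH].
  - apply (is_lim_seq_ext (fun N => u N 0%nat)).
    { intros N; now rewrite sum_n_0r. }
    rewrite sum_n_0r; apply H.
  - apply (is_lim_seq_ext (fun N => sum_n (u N) K + u N (S K))).
    { intros N; now rewrite sum_n_Sr. }
    rewrite sum_n_Sr; now apply is_lim_seq_plus'.
Qed.

Lemma ex_series_bounded (u : nat -> R) (M : R) :
  (forall n, 0 <= u n) -> (forall N, sum_n u N <= M) -> ex_series u.
Proof.
  intros H0 HM.
  destruct (ex_finite_lim_seq_incr (sum_n u) M) as [l Hl].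
  - intros n; rewrite sum_n_Sr; specialize (H0 (S n)); lra.
  - exact HM.
  - exists l; exact Hl.
Qed.

Lemma ex_series_Rle (u v : nat -> R) :
  (forall n, Rabs (u n) <= v n) -> ex_series v -> ex_series u.
Proof. exact (ex_series_le u v). Qed.

Lemma is_series_Rplus (u v : nat -> R) (a b : R) :
  is_series u a -> is_series v b -> is_series (fun n => u n + v n) (a + b).
Proof. exact (is_series_plus u v a b). Qed.

Lemma is_series_Rscal (c : R) (u : nat -> R) (a : R) :
  is_series u a -> is_series (fun n => c * u n) (c * a).
Proof. exact (is_series_scal c u a). Qed.

(** Cut the series at [K]: the tail is at most the tail of [g], small uniformly in [N], and the head
    is a finite sum of null sequences. *)
Lemma is_lim_Series_dominated0 (f : nat -> nat -> R) (g : nat -> R) :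
  (forall N k, Rabs (f N k) <= g k) -> ex_series g ->
  (forall k, is_lim_seq (fun N => f N k) 0) ->
  is_lim_seq (fun N => Series (f N)) 0.
Proof.
  intros Hfg Hg Hf.
  assert (Hg0 : forall k, 0 <= g k).
  { intros k; eapply Rle_trans; [apply Rabs_pos | apply (Hfg 0%nat)]. }
  assert (Hex : forall N, ex_series (fun k => Rabs (f N k))).
  { intros N; apply (ex_series_Rle _ g); [|exact Hg].
    intros k; rewrite Rabs_Rabsolu; apply Hfg. }
  assert (Hsplit : forall N K, Rabs (Series (f N)) <=
            sum_n (fun k => Rabs (f N k)) K + (Series g - sum_n g K)).
  { intros N K.
    eapply Rle_trans; [apply Series_Rabs, Hex|].
    rewrite (Series_incr_n _ (S K)), (Series_incr_n g (S K)); auto with arith.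
    simpl pred. rewrite !sum_n_Reals.
    enough (Series (fun k => Rabs (f N (S K + k)%nat))
            <= Series (fun k => g (S K + k)%nat)) by lra.
    apply Series_le.
    - intros k; split; [apply Rabs_pos | apply Hfg].
    - now apply (ex_series_incr_n g (S K)). }
  apply is_lim_seq_spec; intros eps.
  assert (He : 0 < eps / 2) by (destruct eps; simpl; lra).
  assert (Hgl : is_lim_seq (sum_n g) (Series g)) by exact (Series_correct _ Hg).
  apply is_lim_seq_spec in Hgl.
  destruct (Hgl (mkposreal _ He)) as [K HK].
  specialize (HK K (Nat.le_refl _)); simpl in HK.
  assert (Hs : is_lim_seq (fun N => sum_n (fun k => Rabs (f N k)) K) 0).
  { replace 0 with (sum_n (fun _ => 0) K).
    - apply is_lim_sum_n. intros k.
      replace (Finite 0) with (Rbar_abs (Finite 0)) by (simpl; now rewrite Rabs_R0).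
      apply is_lim_seq_abs, Hf.
    - exact (sum_n_m_const_zero (G := R_AbelianMonoid) 0 K). }
  apply is_lim_seq_spec in Hs.
  destruct (Hs (mkposreal _ He)) as [N0 HN0].
  exists N0; intros N HN; specialize (HN0 N HN); simpl in HN0.
  rewrite Rminus_0_r in *.
  specialize (Hsplit N K).
  apply Rabs_lt_between in HK. apply Rabs_lt_between in HN0. lra.
Qed.

(** The limit [l] inherits the majorant [g], so [f N - l] is dominated by [2 g] and the case of
    limit 0 applies. *)
Lemma is_lim_Series_dominated (f : nat -> nat -> R) (g l : nat -> R) :
  (forall N k, Rabs (f N k) <= g k) -> ex_series g ->
  (forall k, is_lim_seq (fun N => f N k) (l k)) ->
  is_lim_seq (fun N => Series (f N)) (Series l).
Proof.
  intros Hfg Hg Hf.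
  assert (Hl : forall k, Rabs (l k) <= g k).
  { intros k.
    apply (is_lim_seq_le (fun N => Rabs (f N k)) (fun _ => g k)
             (Rabs (l k)) (g k)).
    - intros N; apply Hfg.
    - apply (is_lim_seq_abs _ (l k)), Hf.
    - apply is_lim_seq_const. }
  assert (Exf : forall N, ex_series (f N)).
  { intros N; now apply (ex_series_Rle _ g). }
  assert (Exl : ex_series l) by now apply (ex_series_Rle _ g).
  apply (is_lim_seq_ext (fun N => Series (fun k => f N k - l k) + Series l)).
  { intros N; rewrite Series_minus; auto; ring. }
  replace (Series l) with (0 + Series l) at 1 by ring.
  apply is_lim_seq_plus'; [|apply is_lim_seq_const].
  apply (is_lim_Series_dominated0 _ (fun k => 2 * g k)).
  - intros N k. unfold Rminus.
    eapply Rle_trans; [apply Rabs_triang|].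
    rewrite Rabs_Ropp. specialize (Hfg N k); specialize (Hl k); lra.
  - exact (ex_series_scal 2 g Hg).
  - intros k. replace (Finite 0) with (Finite (l k - l k)) by (f_equal; ring).
    apply is_lim_seq_minus'; [apply Hf | apply is_lim_seq_const].
Qed.

Lemma sum_n_m_Rscal (c : R) (u : nat -> R) (n m : nat) :
  sum_n_m (fun k => c * u k) n m = c * sum_n_m u n m :> R.
Proof. exact (sum_n_m_mult_l c u n m). Qed.

(** * Half-integers and the sums [h] *)

Lemma half_int_S (n : nat) : half_int (S n) = INR n + / 2.
Proof. unfold half_int; rewrite S_INR; lra. Qed.

Lemma half_int_S_ge (n : nat) : INR (S n) / 2 <= half_int (S n).
Proof. rewrite half_int_S, S_INR; pose proof (pos_INR n); lra. Qed.

Lemma half_int_S_ge_half (n : nat) : / 2 <= half_int (S n).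
Proof. rewrite half_int_S; pose proof (pos_INR n); lra. Qed.

Lemma half_int_S_pos (n : nat) : 0 < half_int (S n).
Proof. pose proof (half_int_S_ge_half n); lra. Qed.

Lemma half_int_S_neq0 (n : nat) : half_int (S n) <> 0.
Proof. pose proof (half_int_S_pos n); lra. Qed.

Lemma half_int_SS (n : nat) : half_int (S (S n)) = half_int (S n) + 1.
Proof. rewrite !half_int_S, S_INR; ring. Qed.

(** Parity: after doubling, equality would identify an even integer with an odd one. *)
Lemma nat_sub_half_int_neq0 (k n : nat) : INR k - half_int (S n) <> 0.
Proof.
  rewrite half_int_S; intros H.
  assert (H2 : INR (2 * k) = INR (2 * n + 1)).
  { rewrite plus_INR, !mult_INR; simpl; lra. }
  apply INR_eq in H2; lia.
Qed.

Lemma nat_add_half_int_neq0 (k n : nat) : INR k - - half_int (S n) <> 0.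
Proof. pose proof (half_int_S_pos n); pose proof (pos_INR k); lra. Qed.

Lemma h_0 : h 0 = 0.
Proof. exact (sum_n_m_zero (fun k => / half_int k) 1 0 Nat.lt_0_1). Qed.

Lemma h_S (n : nat) : h (S n) = h n + / half_int (S n).
Proof. exact (sum_n_Sm (fun k => / half_int k) 1 n (le_n_S _ _ (Nat.le_0_l n))). Qed.

Lemma h_nonneg (n : nat) : 0 <= h n.
Proof.
  induction n as [|n IH]; [rewrite h_0; lra|].
  rewrite h_S. pose proof (Rinv_0_lt_compat _ (half_int_S_pos n)); lra.
Qed.

Lemma h_le_S (n : nat) : h n <= h (S n).
Proof. rewrite h_S; pose proof (Rinv_0_lt_compat _ (half_int_S_pos n)); lra. Qed.

(** * Growth of [h] and convergence of the series involved *)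

(* An algebraic majorant, up to a constant, of the logarithmic growth of [h]. *)
Definition root4 (n : nat) : R := sqrt (sqrt (INR (S n))).

Lemma root4_sqr (n : nat) : root4 n ^ 2 = sqrt (INR (S n)).
Proof. unfold root4; rewrite pow2_sqrt; [reflexivity | apply sqrt_pos]. Qed.

Lemma root4_pow4 (n : nat) : root4 n ^ 4 = INR (S n).
Proof.
  replace (root4 n ^ 4) with ((root4 n ^ 2) ^ 2) by ring.
  rewrite root4_sqr, pow2_sqrt; [reflexivity | apply pos_INR].
Qed.

Lemma root4_ge1 (n : nat) : 1 <= root4 n.
Proof.
  unfold root4. rewrite <- sqrt_1 at 1. apply sqrt_le_1_alt.
  rewrite <- sqrt_1 at 1. apply sqrt_le_1_alt.
  rewrite S_INR; pose proof (pos_INR n); lra.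
Qed.

Lemma root4_le (n m : nat) : (n <= m)%nat -> root4 n <= root4 m.
Proof.
  intros H; unfold root4; do 2 apply sqrt_le_1_alt; apply le_INR; lia.
Qed.

(** The fourth powers of consecutive values y <= z differ by 1, and z^4 - y^4 = (z - y)(z^3 + z^2 y
    + z y^2 + y^3) <= 4 z^3 (z - y). *)
Lemma root4_step (n : nat) : / (4 * root4 (S n) ^ 3) <= root4 (S n) - root4 n.
Proof.
  assert (H4 : root4 (S n) ^ 4 - root4 n ^ 4 = 1).
  { rewrite !root4_pow4, (S_INR (S n)); ring. }
  pose proof (root4_ge1 n) as Hy. pose proof (root4_le n (S n) (Nat.le_succ_diag_r n)) as Hyz.
  set (y := root4 n) in *; set (z := root4 (S n)) in *.
  assert (Hz3 : 0 < 4 * z ^ 3) by (pose proof (pow_lt z 3); lra).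
  apply (Rmult_le_reg_l (4 * z ^ 3)); [exact Hz3|].
  rewrite Rinv_r by lra.
  rewrite <- H4.
  replace (z ^ 4 - y ^ 4) with ((z ^ 3 + z ^ 2 * y + z * y ^ 2 + y ^ 3) * (z - y)) by ring.
  apply Rmult_le_compat_r; [lra|].
  assert (y ^ 2 <= z ^ 2) by (apply pow_incr; lra).
  assert (y ^ 3 <= z ^ 3) by (apply pow_incr; lra).
  assert (z ^ 2 * y <= z ^ 2 * z) by (apply Rmult_le_compat_l; nra).
  assert (z * y ^ 2 <= z * z ^ 2) by (apply Rmult_le_compat_l; nra).
  replace (z ^ 2 * z) with (z ^ 3) in * by ring.
  replace (z * z ^ 2) with (z ^ 3) in * by ring.
  lra.
Qed.

(** With z = [root4 (S n)], the increment of [h] is at most 2 / z^4 <= 8 / (4 z^3), hence at most 8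
    times the increment of [root4]. *)
Lemma h_le_root4 (n : nat) : h (S n) <= 8 * root4 n.
Proof.
  induction n as [|n IH].
  - rewrite h_S, h_0. unfold half_int. simpl.
    pose proof (root4_ge1 0). replace (/ (1 - 1 / 2)) with 2 by field. lra.
  - rewrite h_S. pose proof (root4_step n) as Hs. pose proof (half_int_S_ge (S n)) as Ha.
    rewrite <- root4_pow4 in Ha. pose proof (root4_ge1 (S n)) as Hz.
    set (z := root4 (S n)) in *.
    assert (Hz3 : 1 <= z ^ 3) by (apply pow_R1_Rle; lra).
    enough (/ half_int (S (S n)) <= 8 * / (4 * z ^ 3)) by lra.
    replace (8 * / (4 * z ^ 3)) with (/ (z ^ 3 / 2)) by (field; lra).
    apply Rinv_le_contravar; [lra|].
    eapply Rle_trans; [|exact Ha].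
    replace (z ^ 4) with (z ^ 3 * z) by ring. nra.
Qed.

(** Telescoping for the exponent 5/4: with y <= z consecutive values of [root4], 1 / z^5 <= 4 / y -
    4 / z by [root4_step]. *)
Lemma sum_inv_root4_pow5 (N : nat) : sum_n (fun n => / root4 n ^ 5) N <= 5.
Proof.
  enough (H : sum_n (fun n => / root4 n ^ 5) N <= 5 - 4 * / root4 N).
  { pose proof (root4_ge1 N). pose proof (Rinv_0_lt_compat (root4 N)). lra. }
  induction N as [|N IH].
  - rewrite sum_n_0r. replace (root4 0) with 1; [rewrite pow1; lra|].
    unfold root4; simpl; now rewrite !sqrt_1.
  - rewrite sum_n_Sr. pose proof (root4_step N) as Hs. pose proof (root4_ge1 N) as Hy.
    pose proof (root4_ge1 (S N)) as Hz.
    pose proof (root4_le N (S N) (Nat.le_succ_diag_r N)) as Hyz.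
    set (y := root4 N) in *; set (z := root4 (S N)) in *.
    enough (/ z ^ 5 <= 4 * / y - 4 * / z) by lra.
    replace (4 * / y - 4 * / z) with (4 * (z - y) * / (y * z)) by (field; lra).
    apply (Rle_trans _ (4 * / (4 * z ^ 3) * / (z * z))).
    + apply Req_le; field; lra.
    + apply Rmult_le_compat.
      * apply Rmult_le_pos; [lra|]. left; apply Rinv_0_lt_compat.
        pose proof (pow_lt z 3); lra.
      * left; apply Rinv_0_lt_compat; nra.
      * lra.
      * apply Rinv_le_contravar; nra.
Qed.

Lemma inv_root4_pow_nonneg (n p : nat) : 0 <= / root4 n ^ p.
Proof.
  left; apply Rinv_0_lt_compat, pow_lt. pose proof (root4_ge1 n); lra.
Qed.

Lemma ex_series_inv_root4_pow5 : ex_series (fun n => / root4 n ^ 5).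
Proof.
  apply (ex_series_bounded _ 5); [|exact sum_inv_root4_pow5].
  intros n; apply inv_root4_pow_nonneg.
Qed.

(** Two of the factors decay by [half_int (S n)] >= [root4 n ^ 4 / 2]; the other [p] are only
    bounded, by [half_int (S n)] >= 1/2. *)
Lemma inv_half_int_pow_le (n p : nat) :
  / half_int (S n) ^ (p + 2) <= 2 ^ (p + 2) * / root4 n ^ 8.
Proof.
  rewrite <- pow_inv.
  pose proof (half_int_S_ge_half n) as H2. pose proof (half_int_S_ge n) as Ha.
  rewrite <- root4_pow4 in Ha. pose proof (root4_ge1 n) as Hr.
  assert (Hi : 0 < / half_int (S n)) by apply Rinv_0_lt_compat, half_int_S_pos.
  assert (Hr4 : 0 < root4 n ^ 4) by (apply pow_lt; lra).
  rewrite pow_add, (pow_add 2), Rmult_assoc.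
  apply Rmult_le_compat.
  - apply pow_le; lra.
  - apply pow_le; lra.
  - apply pow_incr; split; [lra|]. rewrite <- (Rinv_inv 2) at 1.
    apply Rinv_le_contravar; lra.
  - replace (2 ^ 2 * / root4 n ^ 8) with ((/ (root4 n ^ 4 / 2)) ^ 2) by (field; lra).
    apply pow_incr; split; [lra|]. apply Rinv_le_contravar; lra.
Qed.

(** A weight of order sqrt(n) leaves terms of order [/ root4 n ^ 6], within the summable
    [/ root4 n ^ 5]. The weights used are 1, [h] and [h ^ 2]. *)
Lemma ex_series_weighted_half_int (w : nat -> R) (C : R) (q : nat) : (1 < q)%nat ->
  (forall n, Rabs (w n) <= C * root4 n ^ 2) ->
  ex_series (fun n => w n / half_int (S n) ^ q).
Proof.
  intros hq Hw.
  replace q with (q - 2 + 2)%nat by lia. set (p := (q - 2)%nat).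
  apply (ex_series_Rle _ (fun n => C * 2 ^ (p + 2) * / root4 n ^ 5)).
  - intros n. unfold Rdiv. rewrite Rabs_mult.
    pose proof (root4_ge1 n) as Hr.
    assert (Hi : 0 < / half_int (S n) ^ (p + 2)).
    { apply Rinv_0_lt_compat, pow_lt, half_int_S_pos. }
    rewrite (Rabs_pos_eq (/ _)) by lra.
    specialize (Hw n). pose proof (Rabs_pos (w n)) as H0.
    apply (Rle_trans _ (C * root4 n ^ 2 * (2 ^ (p + 2) * / root4 n ^ 8))).
    + apply Rmult_le_compat; auto; [lra|]. apply inv_half_int_pow_le.
    + replace (C * root4 n ^ 2 * (2 ^ (p + 2) * / root4 n ^ 8))
        with (C * 2 ^ (p + 2) * / root4 n ^ 6) by (field; lra).
      apply Rmult_le_compat_l.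
      * apply Rmult_le_pos; [|apply pow_le; lra].
        apply (Rmult_le_reg_r (root4 n ^ 2)); [apply pow_lt; lra|]. lra.
      * apply Rinv_le_contravar; [apply pow_lt; lra|]. apply Rle_pow; [lra|lia].
  - exact (ex_series_scal (C * 2 ^ (p + 2)) _ ex_series_inv_root4_pow5).
Qed.

Lemma h_bounds (n : nat) : 0 <= h n <= 8 * root4 n.
Proof.
  split; [apply h_nonneg|].
  eapply Rle_trans; [apply h_le_S | apply h_le_root4].
Qed.

Lemma ex_series_h_sqr (q : nat) : (1 < q)%nat ->
  ex_series (fun n => h n ^ 2 / half_int (S n) ^ q).
Proof.
  intros hq. apply (ex_series_weighted_half_int _ 64); [exact hq|].
  intros n. pose proof (h_bounds n) as Hh. rewrite Rabs_pos_eq by nra. nra.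
Qed.

Lemma ex_series_h (q : nat) : (1 < q)%nat ->
  ex_series (fun n => h n / half_int (S n) ^ q).
Proof.
  intros hq. apply (ex_series_weighted_half_int _ 8); [exact hq|].
  intros n. pose proof (h_bounds n) as Hh. pose proof (root4_ge1 n).
  rewrite Rabs_pos_eq by lra. nra.
Qed.

Lemma ex_series_half_int (q : nat) : (1 < q)%nat ->
  ex_series (fun n => 1 / half_int (S n) ^ q).
Proof.
  intros hq. apply (ex_series_weighted_half_int _ 1); [exact hq|].
  intros n. pose proof (root4_ge1 n). rewrite Rabs_R1. nra.
Qed.

Lemma ex_series_zeta (s : nat) : (1 < s)%nat -> ex_series (fun k => / INR (S k) ^ s).
Proof.
  intros hs.
  apply (ex_series_Rle _ (fun n => / root4 n ^ 5)); [|exact ex_series_inv_root4_pow5].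
  intros n. rewrite <- root4_pow4, <- pow_mult.
  rewrite Rabs_pos_eq by apply inv_root4_pow_nonneg.
  pose proof (root4_ge1 n).
  apply Rinv_le_contravar; [apply pow_lt; lra|]. apply Rle_pow; [lra|lia].
Qed.

Lemma ttilde_depth1 (s : nat) : ttilde [s] = Series (fun n => 1 / half_int (S n) ^ s).
Proof. apply Series_ext; intros n; simpl; unfold Rdiv; ring. Qed.

Lemma ttilde_arg1 (s : nat) : ttilde [s; 1%nat] = Series (fun n => h n / half_int (S n) ^ s).
Proof.
  apply Series_ext; intros n. simpl t_below. rewrite Nat.sub_0_r.
  unfold Rdiv. rewrite Rmult_comm. f_equal.
  apply sum_n_m_ext; intros k. now rewrite !Rmult_1_r.
Qed.

(** * Null sequences for the boundary terms *)

Lemma is_lim_inv_sqrt_nat : is_lim_seq (fun n => / root4 n ^ 2) 0.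
Proof.
  apply (is_lim_seq_ext (fun n => / sqrt (INR (S n)))).
  { intros n; now rewrite root4_sqr. }
  replace (Finite 0) with (Rbar_inv p_infty) by reflexivity.
  apply is_lim_seq_inv; [|easy].
  apply (is_lim_seq_incr_1 (fun n => sqrt (INR n))).
  apply (filterlim_comp _ _ _ INR sqrt _ (Rbar_locally p_infty)).
  - apply is_lim_seq_INR.
  - apply filterlim_sqrt_p.
Qed.

Lemma is_lim_inv_half_int (c : R) : is_lim_seq (fun n => / (c + half_int (S n))) 0.
Proof.
  replace (Finite 0) with (Rbar_inv p_infty) by reflexivity.
  apply is_lim_seq_inv; [|easy].
  apply (is_lim_seq_ext (fun n => INR n + (c + / 2))).
  { intros n; rewrite half_int_S; ring. }
  eapply is_lim_seq_plus; [apply is_lim_seq_INR | apply is_lim_seq_const | reflexivity].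
Qed.

Lemma is_lim_h_div (d c : R) :
  is_lim_seq (fun n => (h (S n) - d) / (c + half_int (S n))) 0.
Proof.
  assert (H1 : is_lim_seq (fun n => h (S n) / half_int (S n)) 0).
  { apply (is_lim_seq_le_le (fun _ => 0) _ (fun n => 16 * / root4 n ^ 2)).
    - intros n. pose proof (h_nonneg (S n)) as H0. pose proof (h_le_root4 n) as H8.
      pose proof (half_int_S_ge n) as Ha. rewrite <- root4_pow4 in Ha.
      pose proof (root4_ge1 n) as Hr.
      assert (Hr4 : 0 < root4 n ^ 4) by (apply pow_lt; lra).
      assert (Hi : 0 < / half_int (S n)) by apply Rinv_0_lt_compat, half_int_S_pos.
      split; [apply Rmult_le_pos; lra|].
      apply (Rle_trans _ (8 * root4 n * / (root4 n ^ 4 / 2))).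
      + apply Rmult_le_compat; try lra. apply Rinv_le_contravar; lra.
      + replace (8 * root4 n * / (root4 n ^ 4 / 2)) with (16 * / root4 n ^ 3) by (field; lra).
        apply Rmult_le_compat_l; [lra|].
        apply Rinv_le_contravar; [apply pow_lt; lra|]. apply Rle_pow; [lra|lia].
    - apply is_lim_seq_const.
    - replace (Finite 0) with (Rbar_mult 16 0) by (simpl; f_equal; ring).
      apply is_lim_seq_scal_l, is_lim_inv_sqrt_nat. }
  (* With a = [half_int (S n)], a / (c + a) = 1 - c / (c + a). The identity is claimed only for
     large [n], because c + a can vanish when [c] is negative. *)
  apply (is_lim_seq_ext_loc
           (fun n => h (S n) / half_int (S n) * (1 - c * / (c + half_int (S n)))
                     - d * / (c + half_int (S n)))).
  { destruct (nfloor_ex (Rabs c) (Rabs_pos c)) as [N0 [_ HN0]].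
    exists (S N0); intros n Hn.
    assert (Hn' : INR N0 + 1 <= INR n) by (rewrite <- S_INR; apply le_INR; lia).
    assert (0 < c + half_int (S n)).
    { rewrite half_int_S. pose proof (Rle_abs (- c)). rewrite Rabs_Ropp in *. lra. }
    pose proof (half_int_S_neq0 n). field; split; lra. }
  replace (Finite 0) with (Finite (0 * (1 - c * 0) - d * 0)) by (f_equal; ring).
  apply is_lim_seq_minus'.
  - apply is_lim_seq_mult'; [exact H1|].
    apply is_lim_seq_minus'; [apply is_lim_seq_const|].
    apply is_lim_seq_mult'; [apply is_lim_seq_const | apply is_lim_inv_half_int].
  - apply is_lim_seq_mult'; [apply is_lim_seq_const | apply is_lim_inv_half_int].
Qed.

(** * Harmonic numbers and the constant 2 log 2 *)

(** In the usual indexing this is H_(n+1). *)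
Definition harmonic (n : nat) : R := sum_n (fun k => / INR (S k)) n.

(** Both bounds are ln y <= y - 1, at y = x / (x + 1) and at y = (x + 1) / x. *)
Lemma ln_S_bounds (k : nat) :
  / INR (S (S k)) <= ln (INR (S (S k))) - ln (INR (S k)) <= / INR (S k).
Proof.
  assert (Hk : 0 < INR (S k)) by (apply lt_0_INR; lia).
  assert (Hln : forall x, 0 < x -> ln x <= x - 1).
  { intros x Hx. pose proof (exp_ineq1_le (ln x)). rewrite exp_ln in *; lra. }
  rewrite (S_INR (S k)).
  set (x := INR (S k)) in *. split.
  - pose proof (Hln (x / (x + 1))) as H.
    rewrite ln_div in H by lra.
    replace (x / (x + 1) - 1) with (- / (x + 1)) in H by (field; lra).
    assert (0 < x / (x + 1)) by (apply Rdiv_lt_0_compat; lra). lra.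
  - pose proof (Hln ((x + 1) / x)) as H.
    rewrite ln_div in H by lra.
    replace ((x + 1) / x - 1) with (/ x) in H by (field; lra).
    assert (0 < (x + 1) / x) by (apply Rdiv_lt_0_compat; lra). lra.
Qed.

Lemma harmonic_diff_bounds (n m : nat) :
  ln (INR (S (S (n + m)))) - ln (INR (S (S n))) <= harmonic (n + m) - harmonic n
  <= ln (INR (S (n + m))) - ln (INR (S n)).
Proof.
  induction m as [|m IH].
  - rewrite Nat.add_0_r; lra.
  - rewrite Nat.add_succ_r. unfold harmonic in *. rewrite sum_n_Sr.
    pose proof (ln_S_bounds (n + m)). pose proof (ln_S_bounds (S (n + m))). lra.
Qed.

(** The terms of [h] are twice the reciprocals of odd numbers, and the odd reciprocals up to 2n + 2
    sum to H_(2n+2) - H_(n+1) / 2. *)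
Lemma h_harmonic (n : nat) : h (S n) = 2 * harmonic (n + S n) - harmonic n.
Proof.
  unfold harmonic. induction n as [|n IH].
  - change (0 + 1)%nat with 1%nat.
    rewrite h_S, h_0, sum_n_Sr, !sum_n_0r. unfold half_int; simpl. field.
  - rewrite h_S, IH.
    replace (S n + S (S n))%nat with (S (S (n + S n))) by lia.
    rewrite !sum_n_Sr, half_int_S.
    rewrite !S_INR, plus_INR, S_INR. pose proof (pos_INR n). field. lra.
Qed.

Lemma is_lim_harmonic_sub_h :
  is_lim_seq (fun n => harmonic n - h (S n)) (- 2 * ln 2).
Proof.
  apply (is_lim_seq_ext (fun n => - 2 * (harmonic (n + S n) - harmonic n))).
  { intros n; rewrite h_harmonic; ring. }
  apply is_lim_seq_mult'; [apply is_lim_seq_const|].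
  (* H_(2n+2) - H_(n+1) lies between ln((2n+3)/(n+2)) and ln((2n+2)/(n+1)) = ln 2, and (2n+3)/(n+2)
     = 2 (1 - 1 / (2 (n+2))). *)
  apply (is_lim_seq_le_le
           (fun n => ln 2 + ln (1 - / 2 * / (3 / 2 + half_int (S n))))
           _ (fun n => ln 2)); [| |apply is_lim_seq_const].
  - intros n. pose proof (harmonic_diff_bounds n (S n)) as [Hl Hu].
    assert (Hn := pos_INR n).
    split.
    + eapply Rle_trans; [|exact Hl].
      rewrite <- ln_mult, <- ln_div; [| try (apply lt_0_INR; lia) .. | lra |].
      * apply Req_le; f_equal. rewrite half_int_S, !S_INR, plus_INR, !S_INR. field. lra.
      * rewrite half_int_S.
        enough (/ 2 * / (3 / 2 + (INR n + / 2)) = / (3 + 2 * INR n + 1)) as ->.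
        { pose proof (Rinv_lt_contravar 1 (3 + 2 * INR n + 1)). lra. }
        field; lra.
    + eapply Rle_trans; [exact Hu|].
      rewrite <- ln_div by (apply lt_0_INR; lia). apply Req_le; f_equal.
      rewrite !S_INR, plus_INR, !S_INR. field. lra.
  - replace (Finite (ln 2)) with (Finite (ln 2 + ln (1 - / 2 * 0))).
    2:{ f_equal. rewrite Rmult_0_r, Rminus_0_r, ln_1; ring. }
    apply is_lim_seq_plus'; [apply is_lim_seq_const|].
    apply (is_lim_seq_continuous ln).
    + apply continuity_pt_filterlim, continuous_ln. lra.
    + apply is_lim_seq_minus'; [apply is_lim_seq_const|].
      apply is_lim_seq_mult'; [apply is_lim_seq_const | apply is_lim_inv_half_int].
Qed.

(** * Values of psi(- s) + gamma at the half-odd numbers *)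

(* [Psi s] is psi(- s) + gamma, where psi is the digamma function. *)
Definition Psi (s : R) : R :=
  / s + Series (fun k => / INR (S k) - / (INR (S k) - s)).

(** Relational form of [Psi s = v] that also asserts convergence of the defining series. *)
Definition is_Psi (s v : R) : Prop :=
  is_series (fun k => / INR (S k) - / (INR (S k) - s)) (v - / s).

Lemma is_Psi_unique (s v : R) : is_Psi s v -> Psi s = v.
Proof. intros H; unfold Psi; rewrite (is_series_unique _ _ H); ring. Qed.

Lemma is_lim_inv_nat_sub (s : R) : is_lim_seq (fun n => / (INR (S n) - s)) 0.
Proof.
  apply (is_lim_seq_ext (fun n => / (/ 2 - s + half_int (S n)))).
  { intros n; rewrite half_int_S, S_INR; f_equal; lra. }
  apply is_lim_inv_half_int.
Qed.

(** The partial sums at - a and - (a + 1) differ by a telescoping sum whose last term tends to 0. *)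
Lemma is_Psi_half_int_succ (n : nat) :
  is_Psi (- half_int (S n)) (h n - 2 * ln 2) ->
  is_Psi (- half_int (S (S n))) (h (S n) - 2 * ln 2).
Proof.
  unfold is_Psi; intros H.
  set (a := half_int (S n)) in *.
  assert (Ha : 0 < a) by apply half_int_S_pos.
  change (is_lim_seq (sum_n (fun k => / INR (S k) - / (INR (S k) - - half_int (S (S n)))))
            (h (S n) - 2 * ln 2 - / - half_int (S (S n)))).
  rewrite half_int_SS; fold a.
  apply (is_lim_seq_ext (fun N =>
    sum_n (fun k => / INR (S k) - / (INR (S k) - - a)) N
    + (/ (1 + a) - / (INR (S N) - - (a + 1))))).
  { intros N; induction N as [|N IH].
    - rewrite !sum_n_0r. simpl INR. field; lra.
    - rewrite !sum_n_Sr, <- IH.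
      replace (INR (S (S N)) - - a) with (INR (S N) - - (a + 1)).
      + ring.
      + rewrite (S_INR (S N)); ring. }
  replace (h (S n) - 2 * ln 2 - / - (a + 1))
    with (h n - 2 * ln 2 - / - a + (/ (1 + a) - 0)).
  - apply is_lim_seq_plus'; [exact H|].
    apply is_lim_seq_minus'; [apply is_lim_seq_const | apply is_lim_inv_nat_sub].
  - rewrite h_S; fold a. field; lra.
Qed.

Lemma is_Psi_neg_half_int (n : nat) : is_Psi (- half_int (S n)) (h n - 2 * ln 2).
Proof.
  induction n as [|n IH]; [|now apply is_Psi_half_int_succ].
  unfold is_Psi.
  change (is_lim_seq (sum_n (fun k => / INR (S k) - / (INR (S k) - - half_int 1)))
            (h 0 - 2 * ln 2 - / - half_int 1)).
  (* The numbers 1 / (k + 3/2) are the terms of [h] from the second on: the missing first term is 2,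
     and the extra last one tends to 0. *)
  apply (is_lim_seq_ext (fun N => harmonic N - h (S N) + (2 - / half_int (S (S N))))).
  { intros N. unfold harmonic. induction N as [|N IH].
    - rewrite !sum_n_0r, h_S, h_0. unfold half_int; simpl. field.
    - rewrite !sum_n_Sr, <- IH, (h_S (S N)).
      rewrite !half_int_S.
      replace (INR (S N) - - (INR 0 + / 2)) with (INR (S N) + / 2) by (simpl; lra).
      rewrite (S_INR (S N)). simpl (INR 0).
      replace (INR (S N) + 1 - - (0 + / 2)) with (INR (S N) + 1 + / 2) by lra. ring. }
  replace (h 0 - 2 * ln 2 - / - half_int 1) with (- 2 * ln 2 + (2 - 0)).
  2:{ rewrite h_0, half_int_S; simpl. field. }
  apply is_lim_seq_plus'; [exact is_lim_harmonic_sub_h|].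
  apply is_lim_seq_minus'; [apply is_lim_seq_const|].
  apply (is_lim_seq_ext (fun N => / (1 + half_int (S N)))); [|apply is_lim_inv_half_int].
  intros N; rewrite half_int_SS; f_equal; ring.
Qed.

(** The recurrence Psi(s + 1) = Psi(s) + 1 / (s + 1), again by telescoping, carries the value at -
    1/2 over to 1/2 and then upwards. *)
Lemma is_Psi_half_int (n : nat) : is_Psi (half_int (S n)) (h (S n) - 2 * ln 2).
Proof.
  assert (Hstep : forall s v, s <> 0 -> s + 1 <> 0 ->
            is_Psi s v -> is_Psi (s + 1) (v + / (s + 1))).
  { unfold is_Psi; intros s v Hs Hs1 H.
    change (is_lim_seq (sum_n (fun k => / INR (S k) - / (INR (S k) - (s + 1))))
              (v + / (s + 1) - / (s + 1))).
    apply (is_lim_seq_ext (fun N =>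
      sum_n (fun k => / INR (S k) - / (INR (S k) - s)) N
      + (/ s + / (INR (S N) - s)))).
    { intros N; induction N as [|N IH].
      - rewrite !sum_n_0r. simpl INR.
        replace (1 - (s + 1)) with (- s) by ring. rewrite Rinv_opp. ring.
      - rewrite !sum_n_Sr, <- IH.
        replace (INR (S (S N)) - (s + 1)) with (INR (S N) - s).
        + ring.
        + rewrite (S_INR (S N)); ring. }
    replace (v + / (s + 1) - / (s + 1)) with (v - / s + (/ s + 0)) by ring.
    apply is_lim_seq_plus'; [exact H|].
    apply is_lim_seq_plus'; [apply is_lim_seq_const | apply is_lim_inv_nat_sub]. }
  induction n as [|n IH].
  - rewrite h_S.
    replace (half_int 1) with (- half_int 1 + 1) by (rewrite half_int_S; simpl; lra).
    replace (h 0 + / (- half_int 1 + 1) - 2 * ln 2)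
      with (h 0 - 2 * ln 2 + / (- half_int 1 + 1)) by ring.
    apply Hstep; [rewrite half_int_S; simpl; lra .. | apply is_Psi_neg_half_int].
  - rewrite h_S, half_int_SS.
    replace (h (S n) + / (half_int (S n) + 1) - 2 * ln 2)
      with (h (S n) - 2 * ln 2 + / (half_int (S n) + 1)) by ring.
    pose proof (half_int_S_pos n).
    apply Hstep; [lra .. | exact IH].
Qed.

Lemma Psi_half_int (n : nat) : Psi (half_int (S n)) = h (S n) - 2 * ln 2.
Proof. apply is_Psi_unique, is_Psi_half_int. Qed.

Lemma Psi_neg_half_int (n : nat) : Psi (- half_int (S n)) = h n - 2 * ln 2.
Proof. apply is_Psi_unique, is_Psi_neg_half_int. Qed.

(** The poles of pi tan(pi s), over which all symmetric sums are taken. *)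
Definition half_odd (s : R) : Prop :=
  exists n, s = half_int (S n) \/ s = - half_int (S n).

Lemma half_odd_pos (n : nat) : half_odd (half_int (S n)).
Proof. exists n; now left. Qed.

Lemma half_odd_neg (n : nat) : half_odd (- half_int (S n)).
Proof. exists n; now right. Qed.

Lemma half_odd_neq0 (s : R) : half_odd s -> s <> 0.
Proof. intros [n [-> | ->]]; pose proof (half_int_S_pos n); lra. Qed.

Lemma nat_sub_half_odd_neq0 (k : nat) (s : R) : half_odd s -> INR k - s <> 0.
Proof.
  intros [n [-> | ->]]; [apply nat_sub_half_int_neq0 | apply nat_add_half_int_neq0].
Qed.

Lemma is_Psi_half_odd (s : R) : half_odd s -> is_Psi s (Psi s).
Proof.
  intros [n [-> | ->]].
  - rewrite Psi_half_int; apply is_Psi_half_int.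
  - rewrite Psi_neg_half_int; apply is_Psi_neg_half_int.
Qed.

(** This is psi(x + 1) = psi(x) + 1 / x at x = - s, read off from the known values. *)
Lemma Psi_pred (s : R) : half_odd s -> Psi (s - 1) = Psi s - / s.
Proof.
  intros [n [-> | ->]].
  - destruct n as [|n].
    + replace (half_int 1 - 1) with (- half_int 1) by (rewrite half_int_S; simpl; lra).
      rewrite Psi_half_int, Psi_neg_half_int, h_S; ring.
    + replace (half_int (S (S n)) - 1) with (half_int (S n)) by (rewrite half_int_SS; ring).
      rewrite !Psi_half_int, (h_S (S n)); ring.
  - replace (- half_int (S n) - 1) with (- half_int (S (S n))) by (rewrite half_int_SS; ring).
    rewrite !Psi_neg_half_int, h_S, Rinv_opp; ring.
Qed.

(** * Peeling terms off the partial fraction expansion of [Psi] *)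

Definition pole_term (q : nat) (s : R) (k : nat) : R :=
  / (INR (S k) ^ q * (INR (S k) - s)).

(** Termwise, 1 / (k^(q+1) (k - s)) = (1 / (k^q (k - s)) - 1 / k^(q+1)) / s. *)
Lemma is_series_pole_succ (q : nat) (s r : R) : half_odd s -> (0 < q)%nat ->
  is_series (pole_term q s) r ->
  is_series (pole_term (S q) s) ((r - zeta (q + 1)) / s).
Proof.
  intros Hs Hq H.
  pose proof (half_odd_neq0 s Hs) as Hs0.
  assert (Hz : is_series (fun k => / INR (S k) ^ (q + 1)) (zeta (q + 1))).
  { apply Series_correct, ex_series_zeta; lia. }
  apply (is_series_Rscal (- 1)) in Hz.
  pose proof (is_series_Rscal (/ s) _ _ (is_series_Rplus _ _ _ _ H Hz)) as H1.
  replace ((r - zeta (q + 1)) / s) with (/ s * (r + - 1 * zeta (q + 1))) by (unfold Rdiv; ring).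
  revert H1; apply is_series_ext; intros k. unfold pole_term.
  pose proof (nat_sub_half_odd_neq0 (S k) s Hs) as Hk.
  assert (HS : INR (S k) <> 0) by (apply not_0_INR; lia).
  assert (HSq : INR (S k) ^ q <> 0) by now apply pow_nonzero.
  eq_in_R.
  rewrite pow_add, pow_1, <- tech_pow_Rmult. field; auto.
Qed.

(** For [q] = 1 this is the series of [Psi] divided by - s, as 1/k - 1/(k - s) = - s / (k (k - s));
    each further power of k splits off one zeta value. *)
Lemma is_series_pole (q : nat) (s : R) : half_odd s -> (0 < q)%nat ->
  is_series (pole_term q s)
    (/ s ^ (q + 1) - sum_n_m (fun i => zeta (i + 1) * / s ^ (q - i)) 1 (q - 1)
     - Psi s / s ^ q).
Proof.
  intros Hs Hq. pose proof (half_odd_neq0 s Hs) as Hs0.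
  destruct q as [|q]; [lia|]. clear Hq.
  replace (S q - 1)%nat with q by lia.
  induction q as [|q IH].
  - rewrite sum_n_m_zero by lia. change (@zero R_AbelianMonoid) with 0.
    pose proof (is_series_Rscal (- / s) _ _ (is_Psi_half_odd s Hs)) as H.
    replace (/ s ^ (1 + 1) - 0 - Psi s / s ^ 1) with (- / s * (Psi s - / s))
      by (simpl; field; auto).
    revert H; apply is_series_ext; intros k. unfold pole_term.
    pose proof (nat_sub_half_odd_neq0 (S k) s Hs) as Hk.
    assert (HS : INR (S k) <> 0) by (apply not_0_INR; lia).
    eq_in_R.
    rewrite pow_1. field; auto.
  - apply (is_series_pole_succ (S q)) in IH; [|exact Hs|lia].
    match goal with |- is_series _ ?x =>
      match type of IH with is_series _ ?y => replace x with y; [exact IH|] end end.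
    assert (Hq : s ^ q <> 0) by now apply pow_nonzero.
    rewrite sum_n_Sm by lia.
    rewrite (sum_n_m_ext_loc (fun i => zeta (i + 1) * / s ^ (S (S q) - i))
               (fun i => / s * (zeta (i + 1) * / s ^ (S q - i))) 1 q).
    2:{ intros i Hi. replace (S (S q) - i)%nat with (S (S q - i)) by lia.
        eq_in_R.
        rewrite <- tech_pow_Rmult, Rinv_mult. ring. }
    rewrite sum_n_m_Rscal. change (@plus R_AbelianMonoid) with Rplus.
    replace (S (S q) - S q)%nat with 1%nat by lia.
    eq_in_R.
    rewrite !pow_add. simpl pow. field. auto.
Qed.

(** * Symmetric sums over the half-odd numbers *)

(** Pairing s with - s gives a limit to sums that converge only conditionally, such as those of 1 /
    s and 1 / (k - s). *)
Definition symsum (f : R -> R) (N : nat) : R :=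
  sum_n (fun n => f (half_int (S n)) + f (- half_int (S n))) N.

Lemma symsum_0 (f : R -> R) : symsum f 0 = f (half_int 1) + f (- half_int 1).
Proof. apply sum_n_0r. Qed.

Lemma symsum_S (f : R -> R) (N : nat) :
  symsum f (S N) = symsum f N + (f (half_int (S (S N))) + f (- half_int (S (S N)))).
Proof. apply sum_n_Sr. Qed.

Lemma symsum_ext (f g : R -> R) (N : nat) :
  (forall s, half_odd s -> f s = g s) -> symsum f N = symsum g N.
Proof.
  intros H; apply sum_n_ext; intros n.
  now rewrite !H by (apply half_odd_pos || apply half_odd_neg).
Qed.

Lemma symsum_plus (f g : R -> R) (N : nat) :
  symsum (fun s => f s + g s) N = symsum f N + symsum g N.
Proof.
  induction N as [|N IH].
  - rewrite !symsum_0; ring.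
  - rewrite !symsum_S, IH; ring.
Qed.

Lemma symsum_scal (c : R) (f : R -> R) (N : nat) :
  symsum (fun s => c * f s) N = c * symsum f N.
Proof.
  induction N as [|N IH].
  - rewrite !symsum_0; ring.
  - rewrite !symsum_S, IH; ring.
Qed.

Lemma symsum_sum_n_m (c : nat -> R) (g : nat -> R -> R) (p m N : nat) :
  symsum (fun s => sum_n_m (fun i => c i * g i s) p m) N
  = sum_n_m (fun i => c i * symsum (g i) N) p m.
Proof.
  destruct (le_lt_dec p m) as [Hpm|Hpm].
  - induction Hpm as [|m Hpm IH].
    + rewrite sum_n_n, <- symsum_scal.
      apply symsum_ext; intros s _; now rewrite sum_n_n.
    + rewrite sum_n_Sm, <- IH, <- symsum_scal by lia.
      change (@plus R_AbelianMonoid) with Rplus. rewrite <- symsum_plus.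
      apply symsum_ext; intros s _. now rewrite sum_n_Sm by lia.
  - rewrite sum_n_m_zero by lia. change (@zero R_AbelianMonoid) with 0.
    replace 0 with (0 * symsum (fun _ => 0) N) by ring.
    rewrite <- symsum_scal. apply symsum_ext; intros s _.
    rewrite sum_n_m_zero by lia. change (@zero R_AbelianMonoid) with 0. ring.
Qed.

(** Translation moves the window of points one step to the left: - (N + 3/2) enters and N + 1/2
    leaves. *)
Lemma symsum_shift (f : R -> R) (N : nat) :
  symsum (fun s => f (s - 1)) N
  = symsum f N + f (- half_int (S (S N))) - f (half_int (S N)).
Proof.
  induction N as [|N IH].
  - rewrite !symsum_0.
    replace (half_int 1 - 1) with (- half_int 1) by (rewrite half_int_S; simpl; lra).
    replace (- half_int 1 - 1) with (- half_int 2) by (rewrite half_int_SS; lra).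
    ring.
  - rewrite !symsum_S, IH.
    replace (half_int (S (S N)) - 1) with (half_int (S N)) by (rewrite half_int_SS; lra).
    replace (- half_int (S (S N)) - 1) with (- half_int (S (S (S N))))
      by (rewrite (half_int_SS (S N)); lra).
    ring.
Qed.

Lemma is_series_symsum (f : R -> nat -> R) (l : R -> R) (N : nat) :
  (forall s, half_odd s -> is_series (f s) (l s)) ->
  is_series (fun k => symsum (fun s => f s k) N) (symsum l N).
Proof.
  intros H; induction N as [|N IH].
  - rewrite symsum_0.
    apply (is_series_ext (fun k => f (half_int 1) k + f (- half_int 1) k)).
    { intros k; now rewrite symsum_0. }
    apply is_series_Rplus; apply H; [apply half_odd_pos | apply half_odd_neg].
  - rewrite symsum_S.
    apply (is_series_ext (fun k => symsum (fun s => f s k) N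
             + (f (half_int (S (S N))) k + f (- half_int (S (S N))) k))).
    { intros k; now rewrite symsum_S. }
    apply is_series_Rplus; [exact IH|].
    apply is_series_Rplus; apply H; [apply half_odd_pos | apply half_odd_neg].
Qed.

Lemma is_lim_sum_n_m (u : nat -> nat -> R) (l : nat -> R) (p m : nat) :
  (forall i, (p <= i <= m)%nat -> is_lim_seq (fun N => u N i) (l i)) ->
  is_lim_seq (fun N => sum_n_m (u N) p m) (sum_n_m l p m).
Proof.
  intros H. destruct (le_lt_dec p m) as [Hpm|Hpm].
  - induction Hpm as [|m Hpm IH].
    + rewrite sum_n_n. apply (is_lim_seq_ext (fun N => u N p)).
      { intros N; now rewrite sum_n_n. }
      apply H; lia.
    + apply (is_lim_seq_ext (fun N => sum_n_m (u N) p m + u N (S m))).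
      { intros N; now rewrite sum_n_Sm by lia. }
      rewrite sum_n_Sm by lia. apply is_lim_seq_plus'.
      * apply IH; intros i Hi; apply H; lia.
      * apply H; lia.
  - rewrite sum_n_m_zero by lia. apply (is_lim_seq_ext (fun _ => 0)).
    { intros N; now rewrite sum_n_m_zero by lia. }
    apply is_lim_seq_const.
Qed.

(** Common core of the cases [w] = 1 and [w] = [Psi]: the expansion of [is_series_pole] is
    multiplied by [w] and summed symmetrically. [L] holds the limits for the powers of 1 / s, and
    [c] is the limit D_w(k), the same for every [k]. *)
Lemma is_lim_symsum_mul_Psi (w : R -> R) (L : nat -> R) (c C : R) (q : nat) :
  (1 < q)%nat ->
  (forall j, (1 <= j <= q + 1)%nat -> is_lim_seq (symsum (fun s => w s / s ^ j)) (L j)) ->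
  (forall k, is_lim_seq (symsum (fun s => w s / (INR (S k) - s))) c) ->
  (forall N k, Rabs (symsum (fun s => w s / (INR (S k) - s)) N) <= C * root4 k ^ 2) ->
  is_lim_seq (symsum (fun s => w s * Psi s / s ^ q))
    (L (q + 1)%nat - sum_n_m (fun i => zeta (i + 1) * L (q - i)%nat) 1 (q - 1) - c * zeta q).
Proof.
  intros Hq HL Hc HC.
  (* For each [N] the identity is exact, since only finitely many series over k are added. *)
  apply (is_lim_seq_ext (fun N =>
    symsum (fun s => w s / s ^ (q + 1)) N
    - sum_n_m (fun i => zeta (i + 1) * symsum (fun s => w s / s ^ (q - i)) N) 1 (q - 1)
    - Series (fun k => symsum (fun s => w s / (INR (S k) - s)) N * / INR (S k) ^ q))).
  { intros N.
    assert (Hser : is_series (fun k => symsum (fun s => w s * pole_term q s k) N)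
      (symsum (fun s => w s * (/ s ^ (q + 1)
         - sum_n_m (fun i => zeta (i + 1) * / s ^ (q - i)) 1 (q - 1) - Psi s / s ^ q)) N)).
    { apply is_series_symsum; intros s Hs.
      apply is_series_Rscal, is_series_pole; [exact Hs | lia]. }
    apply is_series_unique in Hser.
    rewrite (Series_ext _ (fun k => symsum (fun s => w s / (INR (S k) - s)) N
                                    * / INR (S k) ^ q)) in Hser.
    2:{ intros k. rewrite Rmult_comm, <- symsum_scal. apply symsum_ext; intros s Hs.
        unfold pole_term. rewrite Rinv_mult. unfold Rdiv; ring. }
    rewrite Hser, <- symsum_sum_n_m.
    match goal with |- ?A - ?B - ?D = ?E =>
      enough (A = B + D + E) by lra end.
    rewrite <- !symsum_plus. apply symsum_ext; intros s Hs.
    rewrite (sum_n_m_ext _ (fun i => w s * (zeta (i + 1) * / s ^ (q - i)))).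
    2:{ intros i; unfold Rdiv; eq_in_R; ring. }
    rewrite sum_n_m_Rscal. unfold Rdiv; ring. }
  apply is_lim_seq_minus'; [apply is_lim_seq_minus'|].
  - apply HL; lia.
  - apply is_lim_sum_n_m; intros i Hi.
    apply is_lim_seq_mult'; [apply is_lim_seq_const | apply HL; lia].
  - unfold zeta. rewrite <- Series_scal_l.
    (* The limit in [N] passes under the sum over [k]: with r = [root4 k] the terms are at most C
       r^2 / r^8 because [q] >= 2. *)
    apply (is_lim_Series_dominated _ (fun k => C * / root4 k ^ 5)).
    + intros N k. rewrite Rabs_mult.
      assert (Hi : 0 <= / INR (S k) ^ q).
      { left; apply Rinv_0_lt_compat, pow_lt, lt_0_INR; lia. }
      rewrite (Rabs_pos_eq (/ _)) by exact Hi.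
      pose proof (root4_ge1 k) as Hr. specialize (HC N k).
      pose proof (Rabs_pos (symsum (fun s => w s / (INR (S k) - s)) N)) as H0.
      apply (Rle_trans _ (C * root4 k ^ 2 * / root4 k ^ 8)).
      * apply Rmult_le_compat; auto.
        rewrite <- root4_pow4, <- pow_mult.
        apply Rinv_le_contravar; [apply pow_lt; lra | apply Rle_pow; [lra | lia]].
      * replace (C * root4 k ^ 2 * / root4 k ^ 8) with (C * / root4 k ^ 6) by (field; lra).
        apply Rmult_le_compat_l.
        -- apply (Rmult_le_reg_r (root4 k ^ 2)); [apply pow_lt; lra | lra].
        -- apply Rinv_le_contravar; [apply pow_lt; lra | apply Rle_pow; [lra | lia]].
    + exact (ex_series_scal C _ ex_series_inv_root4_pow5).
    + intros k. apply is_lim_seq_mult'; [apply Hc | apply is_lim_seq_const].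
Qed.

(** * Bounds, uniform in [N], on the symmetric sums of w(s) / (k - s) *)

(** The points 1/2, ..., 2k + 3/2 are symmetric about k + 1, and each half contributes h_(k+1). The
    induction removes the two end points. *)
Lemma sum_inv_dist_half_int (k : nat) :
  sum_n (fun n => / Rabs (INR (S k) - half_int (S n))) (S (2 * k)) = 2 * h (S k) :> R.
Proof.
  induction k as [|k IH].
  - change (S (2 * 0)) with 1%nat. rewrite sum_n_Sr, sum_n_0r, h_S, h_0, !half_int_S. simpl.
    rewrite Rabs_pos_eq, Rabs_left by lra. field.
  - replace (S (2 * S k)) with (S (S (S (2 * k)))) by lia.
    rewrite sum_n_shift, sum_n_Sr, h_S.
    rewrite (sum_n_ext _ (fun n => / Rabs (INR (S k) - half_int (S n)))).
    2:{ intros n. f_equal; f_equal. rewrite half_int_SS, (S_INR (S k)); ring. }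
    rewrite IH, !half_int_S, !S_INR, mult_INR. simpl (INR 2). simpl (INR 0).
    pose proof (pos_INR k).
    rewrite Rabs_pos_eq, Rabs_left by lra. field; lra.
Qed.

(** The absolute value of 1 / (K - a) + 1 / (K + a), for K = k + 1 and a = [half_int (S n)]. *)
Definition kernel (k n : nat) : R :=
  2 * INR (S k) / (Rabs (INR (S k) - half_int (S n)) * (INR (S k) + half_int (S n))).

Lemma root4_double (k : nat) : root4 (S (2 * k)) <= 2 * root4 k.
Proof.
  pose proof (root4_ge1 k) as Hk. pose proof (root4_ge1 (S (2 * k))) as Hk2.
  destruct (Rle_lt_dec (root4 (S (2 * k))) (2 * root4 k)) as [H|H]; [exact H|].
  assert (H4 : (2 * root4 k) ^ 4 <= root4 (S (2 * k)) ^ 4) by (apply pow_incr; lra).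
  rewrite Rpow_mult_distr, !root4_pow4 in H4.
  replace (S (S (2 * k))) with (2 * S k)%nat in H4 by lia.
  rewrite mult_INR in H4. simpl (INR 2) in H4.
  pose proof (lt_0_INR (S k) (Nat.lt_0_succ k)). lra.
Qed.

(** In this range [root4 n <= 2 * root4 k], and 2 K / (K + a) <= 2. *)
Lemma kernel_near (k n : nat) : (n <= S (2 * k))%nat ->
  root4 n * kernel k n <= 4 * root4 k * / Rabs (INR (S k) - half_int (S n)).
Proof.
  intros Hn.
  pose proof (Rabs_pos_lt _ (nat_sub_half_int_neq0 (S k) n)) as Hd.
  pose proof (half_int_S_pos n) as Ha.
  pose proof (lt_0_INR (S k) (Nat.lt_0_succ k)) as HK.
  pose proof (root4_ge1 n) as Hr.
  pose proof (root4_le _ _ Hn) as Hn'. pose proof (root4_double k) as Hdbl.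
  unfold kernel. set (d := Rabs _) in *. set (a := half_int (S n)) in *.
  set (K := INR (S k)) in *.
  replace (4 * root4 k * / d) with (2 * root4 k * (2 * / d)) by ring.
  apply Rmult_le_compat; [lra | | lra |].
  - apply Rmult_le_pos; [lra|]. left; apply Rinv_0_lt_compat, Rmult_lt_0_compat; lra.
  - apply (Rmult_le_reg_r (d * (K + a))); [apply Rmult_lt_0_compat; lra|].
    replace (2 * K / (d * (K + a)) * (d * (K + a))) with (2 * K) by (field; lra).
    replace (2 * / d * (d * (K + a))) with (2 * (K + a)) by (field; lra). lra.
Qed.

(** Here a >= 2 K, so a - K >= a / 2. Writing K = t^4 <= t^2 r^2, with t = [root4 k] and r =
    [root4 n], keeps only t^2 in the bound and leaves a summable power of r. *)
Lemma kernel_far (k n : nat) : (S (2 * k) < n)%nat ->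
  root4 n * kernel k n <= 16 * root4 k ^ 2 * / root4 n ^ 5.
Proof.
  intros Hn.
  pose proof (half_int_S_ge n) as Ha.
  assert (HaK : 2 * INR (S k) <= half_int (S n)).
  { replace (2 * INR (S k)) with (INR (2 * S k)) by (rewrite mult_INR; simpl; ring).
    rewrite half_int_S. assert (INR (2 * S k) <= INR n) by (apply le_INR; lia). lra. }
  pose proof (lt_0_INR (S k) (Nat.lt_0_succ k)) as HK.
  unfold kernel. rewrite Rabs_left by lra.
  assert (Hkn : root4 k <= root4 n) by (apply root4_le; lia).
  pose proof (root4_ge1 k) as Hk1.
  rewrite <- (root4_pow4 n) in Ha. rewrite <- (root4_pow4 k) in *.
  set (a := half_int (S n)) in *. set (r := root4 n) in *. set (t := root4 k) in *.
  assert (Hr4 : 0 < r ^ 4) by (apply pow_lt; lra).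
  apply (Rle_trans _ (r * (2 * (t ^ 2 * r ^ 2) / (r ^ 4 / 4 * (r ^ 4 / 2))))).
  - apply Rmult_le_compat_l; [lra|]. apply Rmult_le_compat.
    + lra.
    + left; apply Rinv_0_lt_compat, Rmult_lt_0_compat; lra.
    + replace (t ^ 4) with (t ^ 2 * t ^ 2) by ring.
      apply Rmult_le_compat_l; [lra|]. apply Rmult_le_compat_l; [apply pow_le; lra|].
      apply pow_incr; lra.
    + apply Rinv_le_contravar; [apply Rmult_lt_0_compat; lra|].
      apply Rmult_le_compat; lra.
  - apply Req_le. field. lra.
Qed.

(** With t = [root4 k], the near terms give at most 4 t times 2 h_(k+1) <= 64 t^2, and the far terms
    at most 16 t^2 times 5. *)
Lemma sum_root4_kernel (k N : nat) :
  sum_n (fun n => root4 n * kernel k n) N <= 144 * root4 k ^ 2.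
Proof.
  pose proof (root4_ge1 k) as Hk.
  set (u := fun n => if (n <=? S (2 * k))%nat
                     then 4 * root4 k * / Rabs (INR (S k) - half_int (S n)) else 0).
  assert (Hu0 : forall n, 0 <= u n).
  { intros n; unfold u. destruct (n <=? S (2 * k))%nat; [|lra].
    pose proof (Rinv_0_lt_compat _ (Rabs_pos_lt _ (nat_sub_half_int_neq0 (S k) n))).
    apply Rmult_le_pos; lra. }
  assert (Hu : sum_n u N <= 64 * root4 k ^ 2).
  { apply (Rle_trans _ (sum_n u (S (2 * k)))).
    - destruct (le_lt_dec N (S (2 * k))) as [HN|HN]; [now apply sum_n_le_index|].
      apply Req_le. apply Nat.lt_le_incl in HN. induction HN as [|M HM IH]; [reflexivity|].
      rewrite sum_n_Sr, IH. unfold u at 2.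
      destruct (Nat.leb_spec (S M) (S (2 * k))) as [H|H]; [lia|]. ring.
    - rewrite (sum_n_ext_loc _ (fun n => 4 * root4 k * / Rabs (INR (S k) - half_int (S n)))).
      + rewrite sum_n_Rscal, sum_inv_dist_half_int.
        pose proof (h_le_root4 k). nra.
      + intros n Hn; unfold u. destruct (Nat.leb_spec n (S (2 * k))); [reflexivity | lia]. }
  apply (Rle_trans _ (sum_n (fun n => u n + 16 * root4 k ^ 2 * / root4 n ^ 5) N)).
  - apply sum_n_Rle; intros n _.
    assert (H0 : 0 <= 16 * root4 k ^ 2 * / root4 n ^ 5).
    { pose proof (inv_root4_pow_nonneg n 5).
      apply Rmult_le_pos; [|assumption]. nra. }
    destruct (le_lt_dec n (S (2 * k))) as [Hn|Hn].
    + pose proof (kernel_near k n Hn). unfold u.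
      destruct (Nat.leb_spec n (S (2 * k))); [lra | lia].
    + pose proof (kernel_far k n Hn). specialize (Hu0 n); lra.
  - rewrite sum_n_Rplus, sum_n_Rscal.
    assert (16 * root4 k ^ 2 * sum_n (fun n => / root4 n ^ 5) N <= 16 * root4 k ^ 2 * 5).
    { apply Rmult_le_compat_l; [nra | apply sum_inv_root4_pow5]. }
    lra.
Qed.

(** The pair at a, - a equals w(a) (1/(K - a) + 1/(K + a)) - (w(a) - w(- a)) / (K + a). The first
    part is controlled by [kernel]; the second is at most 4 C / r^8 with r = [root4 n], which sums
    to at most 20 C. *)
Lemma symsum_pole_bound (w : R -> R) (B C : R) (k N : nat) :
  0 <= B ->
  (forall n, Rabs (w (half_int (S n))) <= B * root4 n) ->
  (forall n, Rabs (w (half_int (S n)) - w (- half_int (S n))) <= C / half_int (S n)) ->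
  Rabs (symsum (fun s => w s / (INR (S k) - s)) N) <= (144 * B + 20 * C) * root4 k ^ 2.
Proof.
  intros HB Hw Hd.
  assert (HC : 0 <= C).
  { specialize (Hd 0%nat). pose proof (Rabs_pos (w (half_int 1) - w (- half_int 1))).
    apply (Rmult_le_reg_r (/ half_int 1)); [apply Rinv_0_lt_compat, half_int_S_pos|].
    unfold Rdiv in Hd; lra. }
  pose proof (root4_ge1 k) as Hk.
  eapply Rle_trans; [apply sum_n_Rabs|].
  apply (Rle_trans _ (sum_n (fun n => B * (root4 n * kernel k n) + 4 * C * / root4 n ^ 5) N)).
  - apply sum_n_Rle; intros n _.
    pose proof (nat_sub_half_int_neq0 (S k) n) as Hm.
    pose proof (half_int_S_pos n) as Ha. pose proof (half_int_S_ge n) as Har.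
    rewrite <- root4_pow4 in Har. pose proof (root4_ge1 n) as Hr.
    pose proof (lt_0_INR (S k) (Nat.lt_0_succ k)) as HK.
    specialize (Hw n); specialize (Hd n).
    replace (w (half_int (S n)) / (INR (S k) - half_int (S n))
             + w (- half_int (S n)) / (INR (S k) - - half_int (S n)))
      with (w (half_int (S n))
              * (2 * INR (S k) / ((INR (S k) - half_int (S n)) * (INR (S k) + half_int (S n))))
            + - ((w (half_int (S n)) - w (- half_int (S n))) * / (INR (S k) + half_int (S n))))
      by (field; lra).
    eapply Rle_trans; [apply Rabs_triang|]. rewrite Rabs_Ropp, !Rabs_mult.
    apply Rplus_le_compat.
    + rewrite <- Rmult_assoc.
      apply Rmult_le_compat; try apply Rabs_pos; [exact Hw|].
      apply Req_le. unfold kernel, Rdiv.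
      rewrite Rabs_mult, (Rabs_pos_eq (2 * _)), Rabs_inv, Rabs_mult, (Rabs_pos_eq (_ + _)); lra.
    + rewrite (Rabs_pos_eq (/ _)) by (left; apply Rinv_0_lt_compat; lra).
      assert (Hr4 : 0 < root4 n ^ 4) by (apply pow_lt; lra).
      apply (Rle_trans _ (C * / (root4 n ^ 4 / 2) * / (root4 n ^ 4 / 2))).
      * apply Rmult_le_compat.
        -- apply Rabs_pos.
        -- left; apply Rinv_0_lt_compat; lra.
        -- eapply Rle_trans; [exact Hd|]. apply Rmult_le_compat_l; [lra|].
           apply Rinv_le_contravar; lra.
        -- apply Rinv_le_contravar; lra.
      * replace (C * / (root4 n ^ 4 / 2) * / (root4 n ^ 4 / 2))
          with (4 * C * / root4 n ^ 8) by (field; lra).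
        apply Rmult_le_compat_l; [lra|].
        apply Rinv_le_contravar; [apply pow_lt; lra | apply Rle_pow; [lra | lia]].
  - rewrite sum_n_Rplus, !sum_n_Rscal.
    pose proof (sum_root4_kernel k N) as H1. pose proof (sum_inv_root4_pow5 N) as H2.
    assert (1 <= root4 k ^ 2) by (apply pow_R1_Rle; lra).
    apply (Rle_trans _ (B * (144 * root4 k ^ 2) + 4 * C * (5 * root4 k ^ 2))).
    + apply Rplus_le_compat; apply Rmult_le_compat_l; lra.
    + lra.
Qed.

(** * Limits of the symmetric sums for the weights 1 and [Psi] *)

Lemma pow_m1_cases (q : nat) : (-1) ^ q = 1 \/ (-1) ^ q = -1.
Proof.
  induction q as [|q [IH|IH]]; [now left | right | left]; simpl; rewrite IH; ring.
Qed.

Lemma inv_pow_opp (x : R) (q : nat) : / (- x) ^ q = (-1) ^ q * / x ^ q.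
Proof.
  replace (- x) with (-1 * x) by ring. rewrite Rpow_mult_distr, Rinv_mult.
  f_equal. destruct (pow_m1_cases q) as [-> | ->]; field.
Qed.

(** The limit of the symmetric sum of 1 / s^j. At [j] = 1 the factor 0 cancels [ttilde [1]], whose
    series diverges. *)
Definition tsum (j : nat) : R := (1 + (-1) ^ j) * ttilde [j].

Lemma symsum_inv (N : nat) : symsum (fun s => 1 / s ^ 1) N = 0.
Proof.
  induction N as [|N IH].
  - rewrite symsum_0. pose proof (half_int_S_pos 0). field; lra.
  - rewrite symsum_S, IH. pose proof (half_int_S_pos (S N)). field; lra.
Qed.

Lemma is_lim_symsum_pow (j : nat) : (0 < j)%nat ->
  is_lim_seq (symsum (fun s => 1 / s ^ j)) (tsum j).
Proof.
  intros Hj. unfold tsum.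
  destruct (Nat.eq_dec j 1) as [-> | Hj1].
  - replace (Finite _) with (Finite 0) by (f_equal; simpl; ring).
    apply (is_lim_seq_ext (fun _ => 0)); [|apply is_lim_seq_const].
    intros N; now rewrite symsum_inv.
  - rewrite ttilde_depth1.
    assert (H : is_series (fun n => 1 / half_int (S n) ^ j)
                  (Series (fun n => 1 / half_int (S n) ^ j))).
    { apply Series_correct, ex_series_half_int; lia. }
    apply (is_series_Rscal (1 + (-1) ^ j)) in H.
    refine (is_lim_seq_ext _ _ (Finite _) _ H); intros N. apply sum_n_ext; intros n.
    unfold Rdiv; rewrite inv_pow_opp; eq_in_R; ring.
Qed.

(** D_1(k) = 0: at [k] = 0 the summand is odd, and translating by 1 only produces boundary terms
    that tend to 0. *)
Lemma is_lim_symsum_inv_nat_sub (k : nat) :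
  is_lim_seq (symsum (fun s => 1 / (INR k - s))) 0.
Proof.
  induction k as [|k IH].
  - apply (is_lim_seq_ext (fun _ => 0)); [|apply is_lim_seq_const].
    intros N. rewrite (symsum_ext _ (fun s => -1 * (1 / s ^ 1))).
    + rewrite symsum_scal, symsum_inv; ring.
    + intros s Hs. pose proof (half_odd_neq0 s Hs). simpl. field; lra.
  - apply (is_lim_seq_ext (fun N => symsum (fun s => 1 / (INR k - s)) N
      + / (INR k + 1 + half_int (S N)) + / (- INR k + half_int (S N)))).
    { intros N. rewrite (symsum_ext (fun s => 1 / (INR (S k) - s))
                           (fun s => (fun s => 1 / (INR k - s)) (s - 1))).
      - rewrite (symsum_shift (fun s => 1 / (INR k - s))), half_int_SS.
        pose proof (nat_sub_half_int_neq0 k N). pose proof (half_int_S_pos N).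
        pose proof (pos_INR k). field; lra.
      - intros s _. rewrite S_INR. f_equal; ring. }
    replace 0 with (0 + 0 + 0) by ring.
    apply is_lim_seq_plus'; [apply is_lim_seq_plus'|];
      [exact IH | apply is_lim_inv_half_int ..].
Qed.

Lemma is_lim_sum_inv_half_int_sqr : is_lim_seq (sum_n (fun n => 1 / half_int (S n) ^ 2)) (ttilde [2%nat]).
Proof. rewrite ttilde_depth1. apply Series_correct, ex_series_half_int; lia. Qed.

(** Psi(a) - Psi(- a) = 1 / a, so the pair at a, - a contributes 1 / a^2. *)
Lemma is_lim_symsum_Psi_div : is_lim_seq (symsum (fun s => Psi s / s ^ 1)) (ttilde [2%nat]).
Proof.
  generalize is_lim_sum_inv_half_int_sqr; apply is_lim_seq_ext; intros N.
  apply sum_n_ext; intros n. rewrite Psi_half_int, Psi_neg_half_int, h_S.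
  pose proof (half_int_S_pos n).
  eq_in_R. field; lra.
Qed.

(** D_Psi(k) is computed at [k] = 0 and then translated; the boundary terms are of order h_N / N. *)
Lemma is_lim_symsum_Psi_pole (k : nat) :
  is_lim_seq (symsum (fun s => Psi s / (INR k - s))) (- ttilde [2%nat]).
Proof.
  induction k as [|k IH].
  - apply (is_lim_seq_ext (fun N => - symsum (fun s => Psi s / s ^ 1) N)).
    { intros N. rewrite <- (Rmult_1_l (symsum _ _)), Ropp_mult_distr_l, <- symsum_scal.
      apply symsum_ext; intros s Hs. pose proof (half_odd_neq0 s Hs).
      simpl. field; lra. }
    apply (is_lim_seq_opp _ (ttilde [2%nat])), is_lim_symsum_Psi_div.
  - apply (is_lim_seq_ext (fun N => symsum (fun s => Psi s / (INR k - s)) N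
      + (h (S N) - 2 * ln 2) / (INR k + 1 + half_int (S N))
      + (h (S N) - 2 * ln 2) / (- INR k + half_int (S N))
      + / INR (S k) * symsum (fun s => 1 / (INR (S k) - s)) N)).
    { intros N.
      assert (HS : INR (S k) <> 0) by (apply not_0_INR; lia).
      (* By [Psi_pred] the translation leaves the correction 1 / (s (K - s)) = (1/s + 1/(K - s)) /
         K, with K = k + 1. The symmetric sum of 1/s is 0, that of 1/(K - s) tends to 0. *)
      rewrite (symsum_ext (fun s => Psi s / (INR (S k) - s))
                 (fun s => (fun s => Psi s / (INR k - s)) (s - 1)
                           + / INR (S k) * (1 / s ^ 1 + 1 / (INR (S k) - s)))).
      - rewrite symsum_plus, symsum_scal, symsum_plus, symsum_inv.
        rewrite (symsum_shift (fun s => Psi s / (INR k - s))).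
        rewrite Psi_half_int, Psi_neg_half_int, half_int_SS.
        pose proof (nat_sub_half_int_neq0 k N). pose proof (half_int_S_pos N).
        pose proof (pos_INR k).
        set (Y := symsum (fun s => 1 / (INR (S k) - s)) N). field; lra.
      - intros s Hs. rewrite Psi_pred by exact Hs.
        pose proof (half_odd_neq0 s Hs). pose proof (nat_sub_half_odd_neq0 (S k) s Hs).
        replace (INR k - (s - 1)) with (INR (S k) - s) by (rewrite S_INR; ring).
        field; auto. }
    replace (Finite (- ttilde [2%nat]))
      with (Finite (- ttilde [2%nat] + 0 + 0 + / INR (S k) * 0)) by (f_equal; ring).
    apply is_lim_seq_plus'; [apply is_lim_seq_plus'; [apply is_lim_seq_plus'|]|].
    + exact IH.
    + apply is_lim_h_div.
    + apply is_lim_h_div.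
    + apply is_lim_seq_mult'; [apply is_lim_seq_const | apply is_lim_symsum_inv_nat_sub].
Qed.

Definition zeta_tsum_conv (m : nat) : R :=
  sum_n_m (fun i => zeta (i + 1) * tsum (m - i)) 1 (m - 1).

(** The limit of the symmetric sum of Psi(s) / s^q for [q] >= 2. At [q] = 1 the formula gives 2
    t(2), whereas the limit is t(2). *)
Definition Psi_sum (q : nat) : R := tsum (q + 1) - zeta_tsum_conv q.

Lemma is_lim_symsum_Psi (q : nat) : (1 < q)%nat ->
  is_lim_seq (symsum (fun s => Psi s / s ^ q)) (Psi_sum q).
Proof.
  intros Hq.
  apply (is_lim_seq_ext (symsum (fun s => 1 * Psi s / s ^ q))).
  { intros N; apply symsum_ext; intros s _; unfold Rdiv; ring. }
  replace (Psi_sum q) with (Psi_sum q - 0 * zeta q) by ring. unfold Psi_sum, zeta_tsum_conv.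
  apply (is_lim_symsum_mul_Psi (fun _ => 1) tsum 0 (144 * 1 + 20 * 0)); [exact Hq| | |].
  - intros j Hj; apply is_lim_symsum_pow; lia.
  - intros k; apply is_lim_symsum_inv_nat_sub.
  - intros N k. apply (symsum_pole_bound (fun _ => 1)); [lra | |].
    + intros n; rewrite Rabs_R1; pose proof (root4_ge1 n); lra.
    + intros n. rewrite Rminus_diag, Rabs_R0; lra.
Qed.

Lemma ln2_bounds : 0 <= ln 2 <= 1.
Proof.
  split.
  - rewrite <- ln_1; apply ln_le; lra.
  - pose proof (exp_ineq1_le (ln 2)). rewrite exp_ln in *; lra.
Qed.

Lemma is_lim_symsum_Psi_sqr (q : nat) : (1 < q)%nat ->
  is_lim_seq (symsum (fun s => Psi s * Psi s / s ^ q))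
    (Psi_sum (q + 1)
     - sum_n_m (fun i => zeta (i + 1) * Psi_sum (q - i)) 1 (q - 1)
     + 2 * ttilde [2%nat] * zeta q).
Proof.
  intros Hq.
  (* [Psi_sum] has the wrong value at 1. Using it there all the same, in the term i = q - 1, is
     compensated by raising the coefficient of zeta(q) from t(2) to 2 t(2) = pi^2. *)
  set (L := fun j => if (j =? 1)%nat then ttilde [2%nat] else Psi_sum j).
  replace (Psi_sum (q + 1)
     - sum_n_m (fun i => zeta (i + 1) * Psi_sum (q - i)) 1 (q - 1)
     + 2 * ttilde [2%nat] * zeta q)
  with (L (q + 1)%nat - sum_n_m (fun i => zeta (i + 1) * L (q - i)%nat) 1 (q - 1)
        - - ttilde [2%nat] * zeta q).
  (* B = 10 comes from |h_(n+1) - 2 log 2| <= 8 [root4 n] + 2, and C = 1 from Psi(a) - Psi(- a) = 1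
     / a. *)
  - apply (is_lim_symsum_mul_Psi Psi L (- ttilde [2%nat]) (144 * 10 + 20 * 1)); [exact Hq| | |].
    + intros j Hj. unfold L. destruct (Nat.eqb_spec j 1) as [-> | Hj1].
      * apply is_lim_symsum_Psi_div.
      * apply is_lim_symsum_Psi; lia.
    + intros k; apply is_lim_symsum_Psi_pole.
    + intros N k. apply symsum_pole_bound; [lra | |].
      * intros n. rewrite Psi_half_int.
        pose proof (h_nonneg (S n)). pose proof (h_le_root4 n). pose proof (root4_ge1 n).
        pose proof ln2_bounds. apply Rabs_le; lra.
      * intros n. rewrite Psi_half_int, Psi_neg_half_int, h_S.
        pose proof (Rinv_0_lt_compat _ (half_int_S_pos n)).
        apply Rabs_le; unfold Rdiv; lra.
  - destruct q as [|[|q]]; [lia | lia |].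
    replace (S (S q) - 1)%nat with (S q) by lia.
    rewrite !sum_n_Sm by lia. change (@plus R_AbelianMonoid) with Rplus.
    rewrite (sum_n_m_ext_loc (fun i => zeta (i + 1) * L (S (S q) - i)%nat)
               (fun i => zeta (i + 1) * Psi_sum (S (S q) - i)) 1 q).
    2:{ intros i Hi. unfold L. destruct (Nat.eqb_spec (S (S q) - i) 1); [lia | reflexivity]. }
    replace (S (S q) - S q)%nat with 1%nat by lia.
    unfold L at 2. simpl (1 =? 1)%nat.
    unfold L. destruct (Nat.eqb_spec (S (S q) + 1) 1); [lia|].
    replace (Psi_sum 1) with (2 * ttilde [2%nat]).
    2:{ unfold Psi_sum, zeta_tsum_conv, tsum. rewrite sum_n_m_zero by lia.
        change (@zero R_AbelianMonoid) with 0. simpl (1 + 1)%nat. simpl pow. ring. }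
    replace (S q + 1)%nat with (S (S q)) by lia. ring.
Qed.

(** * The value t(2) = pi^2 / 2 *)

(** The derivative of sin y - y cos y is y sin y, which is nonnegative here. *)
Lemma mul_cos_le_sin (x : R) : 0 <= x <= PI / 2 -> x * cos x <= sin x.
Proof.
  intros [H0 Hx].
  destruct (MVT_gen (fun y => sin y - y * cos y) 0 x (fun y => y * sin y)) as [c [Hc He]].
  - intros y _. auto_derive; [easy | ring].
  - intros y _. apply continuity_pt_filterlim.
    apply (ex_derive_continuous (fun y => sin y - y * cos y)). now auto_derive.
  - rewrite Rmin_left, Rmax_right in Hc by lra.
    rewrite sin_0, Rmult_0_l in He.
    assert (0 <= sin c) by (apply sin_ge_0; lra).
    assert (0 <= c * sin c * (x - 0)) by (apply Rmult_le_pos; [apply Rmult_le_pos|]; lra).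
    lra.
Qed.

(** The lower bound is cot(x)^2, so these are the inequalities sin x < x <= tan x. *)
Lemma inv_sqr_bounds (x : R) : 0 < x < PI / 2 -> / sin x ^ 2 - 1 <= / x ^ 2 <= / sin x ^ 2.
Proof.
  intros Hx.
  assert (Hs : 0 < sin x) by (apply sin_gt_0; lra).
  assert (Hc : 0 <= cos x) by (apply cos_ge_0; lra).
  assert (Hsx : sin x < x) by (apply sin_lt_x; lra).
  assert (Hcs : x * cos x <= sin x) by (apply mul_cos_le_sin; lra).
  assert (H1 : sin x ^ 2 = 1 - cos x ^ 2) by (pose proof (sin2_cos2 x); unfold Rsqr in *; nra).
  assert (Hs2 : 0 < sin x ^ 2) by (apply pow_lt; lra).
  assert (Hx2 : 0 < x ^ 2) by (apply pow_lt; lra).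
  split.
  - replace (/ sin x ^ 2 - 1) with (cos x ^ 2 * / sin x ^ 2).
    + apply (Rmult_le_reg_r (sin x ^ 2 * x ^ 2)); [apply Rmult_lt_0_compat; lra|].
      replace (cos x ^ 2 * / sin x ^ 2 * (sin x ^ 2 * x ^ 2)) with ((x * cos x) ^ 2) by (field; lra).
      replace (/ x ^ 2 * (sin x ^ 2 * x ^ 2)) with (sin x ^ 2) by (field; lra).
      apply pow_incr; split; [apply Rmult_le_pos; lra | exact Hcs].
    + apply (Rmult_eq_reg_r (sin x ^ 2)); [|lra].
      replace (cos x ^ 2 * / sin x ^ 2 * sin x ^ 2) with (cos x ^ 2) by (field; lra).
      replace ((/ sin x ^ 2 - 1) * sin x ^ 2) with (1 - sin x ^ 2) by (field; lra). lra.
  - apply Rinv_le_contravar; [lra|]. apply pow_incr; lra.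
Qed.

Lemma sum_n_pairs (u : nat -> R) (N : nat) :
  sum_n u (S (2 * N)) = sum_n (fun k => u (2 * k)%nat + u (S (2 * k))) N :> R.
Proof.
  induction N as [|N IH].
  - change (S (2 * 0)) with 1%nat. now rewrite sum_n_Sr, !sum_n_0r.
  - replace (S (2 * S N)) with (S (S (S (2 * N)))) by lia.
    rewrite (sum_n_Sr u), (sum_n_Sr u), IH, sum_n_Sr.
    replace (2 * S N)%nat with (S (S (2 * N))) by lia. ring.
Qed.

Lemma inv_sin_sqr_duplication (x : R) : 0 < x < PI ->
  / sin (x / 2) ^ 2 + / sin ((x + PI) / 2) ^ 2 = 4 * / sin x ^ 2.
Proof.
  intros Hx.
  replace ((x + PI) / 2) with (PI / 2 + x / 2) by field. rewrite <- cos_sin.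
  assert (Hs : 0 < sin (x / 2)) by (apply sin_gt_0; lra).
  assert (Hc : 0 < cos (x / 2)) by (apply cos_gt_0; lra).
  replace (sin x) with (2 * sin (x / 2) * cos (x / 2)) by (rewrite <- sin_2a; f_equal; field).
  pose proof (sin2_cos2 (x / 2)) as H1. unfold Rsqr in H1.
  set (s := sin (x / 2)) in *; set (c := cos (x / 2)) in *.
  replace (/ s ^ 2 + / c ^ 2) with ((s * s + c * c) * / (s ^ 2 * c ^ 2)) by (field; lra).
  rewrite H1. field; lra.
Qed.

(* The angles (x + j pi) / 2^(n+1) for - 2^n <= j < 2^n, so that at [x = pi / 2] they are
   symmetric about 0. *)
Lemma sum_inv_sin_sqr (n : nat) (x : R) : 0 < x < PI ->
  sum_n (fun k => / sin ((x + INR k * PI) / 2 ^ (n + 1)) ^ 2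
                  + / sin ((x - INR (S k) * PI) / 2 ^ (n + 1)) ^ 2) (2 ^ n - 1)
  = 4 ^ (n + 1) * / sin x ^ 2 :> R.
Proof.
  revert x; induction n as [|n IH]; intros x Hx.
  - simpl (2 ^ 0 - 1)%nat. rewrite sum_n_0r. simpl (0 + 1)%nat. rewrite !pow_1.
    rewrite <- inv_sin_sqr_duplication by exact Hx. simpl INR.
    replace ((x - 1 * PI) / 2) with ((x + PI) / 2 - PI) by field.
    rewrite sin_minus, cos_PI, sin_PI.
    replace ((x + 0 * PI) / 2) with (x / 2) by field.
    do 2 f_equal. ring.
  (* Duplication reduces [x] to x / 2 and (x + pi) / 2, both in (0, pi); their angles are those of
     [x] with even and with odd multiples of pi. *)
  - replace (4 ^ (S n + 1) * / sin x ^ 2)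
      with (4 ^ (n + 1) * / sin (x / 2) ^ 2 + 4 ^ (n + 1) * / sin ((x + PI) / 2) ^ 2).
    2:{ rewrite <- Rmult_plus_distr_l, inv_sin_sqr_duplication by exact Hx.
        replace (S n + 1)%nat with (S (n + 1)) by lia. simpl. ring. }
    rewrite <- !IH by lra. rewrite <- sum_n_Rplus.
    assert (H2 : (1 <= 2 ^ n)%nat) by (pose proof (Nat.pow_nonzero 2 n); lia).
    replace (2 ^ S n - 1)%nat with (S (2 * (2 ^ n - 1))) by (simpl; lia).
    rewrite sum_n_pairs. apply sum_n_ext; intros k.
    eq_in_R.
    assert (Hp : 2 ^ (n + 1) <> 0) by (apply pow_nonzero; lra).
    replace (2 ^ (S n + 1)) with (2 * 2 ^ (n + 1)) by reflexivity.
    rewrite !S_INR, mult_INR. replace (INR 2) with 2 by reflexivity.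
    replace ((x / 2 + INR k * PI) / 2 ^ (n + 1))
      with ((x + 2 * INR k * PI) / (2 * 2 ^ (n + 1))) by (field; exact Hp).
    replace ((x / 2 - (INR k + 1) * PI) / 2 ^ (n + 1))
      with ((x - (2 * INR k + 1 + 1) * PI) / (2 * 2 ^ (n + 1))) by (field; exact Hp).
    replace (((x + PI) / 2 + INR k * PI) / 2 ^ (n + 1))
      with ((x + (2 * INR k + 1) * PI) / (2 * 2 ^ (n + 1))) by (field; exact Hp).
    replace (((x + PI) / 2 - (INR k + 1) * PI) / 2 ^ (n + 1))
      with ((x - (2 * INR k + 1) * PI) / (2 * 2 ^ (n + 1))) by (field; exact Hp).
    ring.
Qed.

(** With c = pi / 2^(n+1), the sum of 1 / sin(a c)^2 over the first 2^n half-integers a is 4^(n+1) /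
    2. Replacing each term by 1 / (a c)^2 loses at most 1, hence 2^n in all, and c^2 2^n = (pi^2 /
    4) 2^(-n). *)
Lemma partial_sum_inv_sqr_bounds (n : nat) :
  PI ^ 2 / 2 - PI ^ 2 / 4 * (/ 2) ^ n
  <= sum_n (fun k => 1 / half_int (S k) ^ 2) (2 ^ n - 1) <= PI ^ 2 / 2.
Proof.
  pose proof PI_RGT_0 as HPI.
  set (c := PI / 2 ^ (n + 1)).
  assert (Hp : 0 < 2 ^ (n + 1)) by (apply pow_lt; lra).
  assert (Hc : 0 < c) by (apply Rdiv_lt_0_compat; lra).
  assert (Hsum : 2 * sum_n (fun k => / sin (half_int (S k) * c) ^ 2) (2 ^ n - 1) = 4 ^ (n + 1)).
  { assert (Hx : 0 < PI / 2 < PI) by lra.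
    pose proof (sum_inv_sin_sqr n (PI / 2) Hx) as H.
    rewrite sin_PI2, pow1, Rinv_1, Rmult_1_r in H.
    rewrite <- H, <- sum_n_Rscal. apply sum_n_ext; intros k.
    eq_in_R.
    rewrite S_INR.
    replace ((PI / 2 - (INR k + 1) * PI) / 2 ^ (n + 1)) with (- (half_int (S k) * c))
      by (rewrite half_int_S; unfold c; field; lra).
    replace ((PI / 2 + INR k * PI) / 2 ^ (n + 1)) with (half_int (S k) * c)
      by (rewrite half_int_S; unfold c; field; lra).
    rewrite sin_neg.
    replace ((- sin (half_int (S k) * c)) ^ 2) with (sin (half_int (S k) * c) ^ 2) by ring.
    ring. }
  assert (H2n : INR (S (2 ^ n - 1)) = 2 ^ n).
  { replace (S (2 ^ n - 1)) with (2 ^ n)%nat by (pose proof (Nat.pow_nonzero 2 n); lia).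
    rewrite pow_INR. reflexivity. }
  assert (Hb : forall k, (k <= 2 ^ n - 1)%nat ->
    / sin (half_int (S k) * c) ^ 2 - 1 <= / (half_int (S k) * c) ^ 2
    <= / sin (half_int (S k) * c) ^ 2).
  { intros k Hk. apply inv_sqr_bounds.
    pose proof (half_int_S_pos k) as Ha. split; [apply Rmult_lt_0_compat; lra|].
    assert (Hk' : INR (S k) <= 2 ^ n) by (rewrite <- H2n; apply le_INR; lia).
    replace (PI / 2) with (2 ^ n * c).
    - apply Rmult_lt_compat_r; [lra|]. rewrite half_int_S. rewrite S_INR in Hk'. lra.
    - unfold c. rewrite pow_add, pow_1. assert (0 < 2 ^ n) by (apply pow_lt; lra). field; lra. }
  assert (Hsc : sum_n (fun k => / (half_int (S k) * c) ^ 2) (2 ^ n - 1)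
          = / c ^ 2 * sum_n (fun k => 1 / half_int (S k) ^ 2) (2 ^ n - 1)).
  { rewrite <- sum_n_Rscal. apply sum_n_ext; intros k.
    eq_in_R.
    pose proof (half_int_S_pos k). field; lra. }
  assert (Hup : sum_n (fun k => / (half_int (S k) * c) ^ 2) (2 ^ n - 1) <= 4 ^ (n + 1) / 2).
  { replace (4 ^ (n + 1) / 2) with (sum_n (fun k => / sin (half_int (S k) * c) ^ 2) (2 ^ n - 1))
      by lra.
    apply sum_n_Rle; intros k Hk; apply Hb, Hk. }
  assert (Hlo : 4 ^ (n + 1) / 2 - 2 ^ n <= sum_n (fun k => / (half_int (S k) * c) ^ 2) (2 ^ n - 1)).
  { apply (Rle_trans _ (sum_n (fun k => / sin (half_int (S k) * c) ^ 2 + -1) (2 ^ n - 1))).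
    - rewrite sum_n_Rplus, sum_n_const, H2n. lra.
    - apply sum_n_Rle; intros k Hk. specialize (Hb k Hk); lra. }
  rewrite Hsc in Hup, Hlo.
  set (X := sum_n (fun k => 1 / half_int (S k) ^ 2) (2 ^ n - 1)) in *.
  assert (H4 : 4 ^ (n + 1) = 2 ^ (n + 1) * 2 ^ (n + 1)).
  { rewrite <- Rpow_mult_distr. f_equal; ring. }
  assert (Hc2 : c ^ 2 * 4 ^ (n + 1) = PI ^ 2) by (unfold c; rewrite H4; field; lra).
  assert (Hc2p : 0 < c ^ 2) by (apply pow_lt; lra).
  replace X with (c ^ 2 * (/ c ^ 2 * X)) by (field; lra).
  assert (Hh : c ^ 2 * 2 ^ n = PI ^ 2 / 4 * (/ 2) ^ n).
  { rewrite <- Hc2, H4, pow_inv, !pow_add, pow_1.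
    assert (0 < 2 ^ n) by (apply pow_lt; lra). field; lra. }
  split.
  - apply (Rle_trans _ (c ^ 2 * (4 ^ (n + 1) / 2 - 2 ^ n))); [lra|].
    apply Rmult_le_compat_l; lra.
  - apply (Rle_trans _ (c ^ 2 * (4 ^ (n + 1) / 2))); [|lra].
    apply Rmult_le_compat_l; lra.
Qed.

Lemma ttilde_2 : ttilde [2%nat] = PI ^ 2 / 2.
Proof.
  assert (H1 : is_lim_seq (fun n => sum_n (fun k => 1 / half_int (S k) ^ 2) (2 ^ n - 1))
                 (ttilde [2%nat])).
  { apply (is_lim_seq_subseq (sum_n (fun k => 1 / half_int (S k) ^ 2)) _ (fun n => 2 ^ n - 1)%nat).
    - apply eventually_subseq; intros n. simpl.
      pose proof (Nat.pow_nonzero 2 n). lia.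
    - exact is_lim_sum_inv_half_int_sqr. }
  assert (H2 : is_lim_seq (fun n => sum_n (fun k => 1 / half_int (S k) ^ 2) (2 ^ n - 1))
                 (PI ^ 2 / 2)).
  { apply (is_lim_seq_le_le (fun n => PI ^ 2 / 2 - PI ^ 2 / 4 * (/ 2) ^ n) _
             (fun _ => PI ^ 2 / 2)).
    - exact partial_sum_inv_sqr_bounds.
    - replace (Finite (PI ^ 2 / 2)) with (Finite (PI ^ 2 / 2 - PI ^ 2 / 4 * 0)) by (f_equal; ring).
      apply is_lim_seq_minus'; [apply is_lim_seq_const|].
      apply is_lim_seq_mult'; [apply is_lim_seq_const|].
      apply is_lim_seq_geom. rewrite Rabs_pos_eq; lra.
    - apply is_lim_seq_const. }
  apply is_lim_seq_unique in H1. apply is_lim_seq_unique in H2. congruence.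
Qed.

(** * The constrained sums as convolutions of [zeta] and [tsum] *)

Lemma sum_n_m_switch (u : nat -> nat -> R) (p m r s : nat) :
  sum_n_m (fun i => sum_n_m (u i) r s) p m
  = sum_n_m (fun j => sum_n_m (fun i => u i j) p m) r s :> R.
Proof.
  destruct (le_lt_dec p m) as [Hpm|Hpm].
  - induction Hpm as [|m Hpm IH].
    + rewrite sum_n_n. apply sum_n_m_ext; intros j; now rewrite sum_n_n.
    + rewrite sum_n_Sm, IH, <- sum_n_m_plus by lia.
      apply sum_n_m_ext; intros j; now rewrite sum_n_Sm by lia.
  - rewrite sum_n_m_zero by lia.
    rewrite (sum_n_m_ext _ (fun _ => zero)); [now rewrite sum_n_m_const_zero|].
    intros j; now rewrite sum_n_m_zero by lia.
Qed.

Lemma sum_n_m_truncate (f : nat -> R) (m B : nat) : (m <= B)%nat ->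
  sum_n_m (fun i => if (i <=? m)%nat then f i else 0) 1 B = sum_n_m f 1 m.
Proof.
  intros H; induction H as [|B HB IH].
  - apply sum_n_m_ext_loc; intros i Hi. destruct (Nat.leb_spec i m); [reflexivity | lia].
  - rewrite sum_n_Sm, IH by lia. destruct (Nat.leb_spec (S B) m); [lia|].
    exact (plus_zero_r _).
Qed.

(** For even [j] only k = j / 2 survives, and it lies in the range; for odd [j] both sides
    vanish. *)
Lemma sum_n_m_select_even (g : nat -> R) (j B : nat) : (0 < j <= 2 * B)%nat ->
  2 * sum_n_m (fun k => if (2 * k =? j)%nat then g (2 * k)%nat else 0) 1 B
  = (1 + (-1) ^ j) * g j.
Proof.
  intros Hj.
  destruct (Nat.Even_or_Odd j) as [[p Hp]|[p Hp]].
  - assert (Hsel : forall C, sum_n_m (fun k => if (2 * k =? j)%nat then g (2 * k)%nat else 0) 1 C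
                   = if (p <=? C)%nat then g j else 0).
    { induction C as [|C IH].
      - rewrite sum_n_m_zero by lia. destruct (Nat.leb_spec p 0); [lia | reflexivity].
      - rewrite sum_n_Sm, IH by lia. change (@plus R_AbelianMonoid) with Rplus.
        destruct (Nat.leb_spec p C), (Nat.leb_spec p (S C)), (Nat.eqb_spec (2 * S C) j);
          try lia; eq_in_R; try ring.
        rewrite e; ring. }
    rewrite Hsel. destruct (Nat.leb_spec p B); [|lia].
    rewrite Hp at 2. rewrite pow_mult. replace ((-1) ^ 2) with 1 by ring. rewrite pow1. ring.
  - rewrite (sum_n_m_ext _ (fun _ => zero)).
    + rewrite sum_n_m_const_zero. change (@zero R_AbelianMonoid) with 0.
      rewrite Hp at 1. rewrite pow_add, pow_mult. replace ((-1) ^ 2) with 1 by ring.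
      rewrite pow1. ring.
    + intros k. destruct (Nat.eqb_spec (2 * k) j); [lia | reflexivity].
Qed.

(** The parity factor of [tsum] encodes that m - k2 = 2 k1 is even. The bound [B] is free because
    the inner sums of [sum3] run up to [q] while their constraint is [q - k3]. *)
Lemma zeta_tsum_conv_select (m B : nat) : (m <= B)%nat ->
  2 * sum_n_m (fun k1 => sum_n_m (fun k2 => if (2 * k1 + k2 =? m)%nat
        then ttilde [(2 * k1)%nat] * zeta (k2 + 1) else 0) 1 B) 1 B = zeta_tsum_conv m.
Proof.
  intros HB. rewrite sum_n_m_switch, <- sum_n_m_Rscal. unfold zeta_tsum_conv.
  destruct (Nat.eq_dec m 0) as [-> | Hm].
  - rewrite (sum_n_m_zero _ 1 (0 - 1)) by lia.
    rewrite <- (sum_n_m_const_zero (G := R_AbelianMonoid) 1 B).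
    apply sum_n_m_ext_loc; intros k2 Hk2.
    rewrite (sum_n_m_ext _ (fun _ => zero)).
    + rewrite sum_n_m_const_zero. exact (Rmult_0_r 2).
    + intros k1. destruct (Nat.eqb_spec (2 * k1 + k2) 0); [lia | reflexivity].
  - rewrite <- (sum_n_m_truncate _ (m - 1) B) by lia.
    apply sum_n_m_ext_loc; intros k2 Hk2.
    destruct (Nat.leb_spec k2 (m - 1)) as [Hk|Hk].
    + unfold tsum. rewrite <- (sum_n_m_select_even (fun j => ttilde [j]) (m - k2) B) by lia.
      rewrite (sum_n_m_ext (fun k1 => if (2 * k1 + k2 =? m)%nat
                  then ttilde [(2 * k1)%nat] * zeta (k2 + 1) else 0)
                (fun k1 => zeta (k2 + 1)
                * (if (2 * k1 =? m - k2)%nat then ttilde [(2 * k1)%nat] else 0))).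
      * rewrite sum_n_m_Rscal. rewrite <- Rmult_assoc, (Rmult_comm 2), Rmult_assoc. reflexivity.
      * intros k1. eq_in_R.
        destruct (Nat.eqb_spec (2 * k1 + k2) m), (Nat.eqb_spec (2 * k1) (m - k2));
          try lia; ring.
    + rewrite (sum_n_m_ext_loc _ (fun _ => zero)).
      * rewrite sum_n_m_const_zero. exact (Rmult_0_r 2).
      * intros k1 Hk1. destruct (Nat.eqb_spec (2 * k1 + k2) m); [lia | reflexivity].
Qed.

Lemma sum2_zeta_tsum (m : nat) :
  2 * sum2 m (fun k1 k2 => ttilde [(2 * k1)%nat] * zeta (k2 + 1)) = zeta_tsum_conv m.
Proof. now apply zeta_tsum_conv_select. Qed.

Lemma sum3_zeta_tsum (q : nat) : (0 < q)%nat ->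
  2 * sum3 q (fun k1 k2 k3 => ttilde [(2 * k1)%nat] * zeta (k2 + 1) * zeta (k3 + 1))
  = sum_n_m (fun i => zeta (i + 1) * zeta_tsum_conv (q - i)) 1 (q - 1).
Proof.
  intros Hq. unfold sum3.
  rewrite (sum_n_m_ext _ (fun k1 => sum_n_m (fun k3 => sum_n_m (fun k2 =>
    if (2 * k1 + k2 + k3 =? q)%nat
    then ttilde [(2 * k1)%nat] * zeta (k2 + 1) * zeta (k3 + 1) else 0) 1 q) 1 q)).
  2:{ intros k1; apply sum_n_m_switch. }
  rewrite sum_n_m_switch, <- sum_n_m_Rscal.
  (* The added term i = q contains [zeta_tsum_conv 0], an empty sum. *)
  replace (sum_n_m (fun i => zeta (i + 1) * zeta_tsum_conv (q - i)) 1 (q - 1))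
    with (sum_n_m (fun i => zeta (i + 1) * zeta_tsum_conv (q - i)) 1 q).
  - apply sum_n_m_ext_loc; intros k3 Hk3.
    rewrite <- (zeta_tsum_conv_select (q - k3) q) by lia.
    rewrite <- Rmult_assoc, (Rmult_comm _ 2), Rmult_assoc.
    eq_in_R. f_equal.
    rewrite <- sum_n_m_Rscal. apply sum_n_m_ext; intros k1.
    rewrite <- sum_n_m_Rscal. apply sum_n_m_ext; intros k2.
    eq_in_R.
    destruct (Nat.eqb_spec (2 * k1 + k2 + k3) q), (Nat.eqb_spec (2 * k1 + k2) (q - k3));
      try lia; ring.
  - destruct q as [|q]; [lia|]. replace (S q - 1)%nat with q by lia.
    rewrite sum_n_Sm by lia. rewrite Nat.sub_diag.
    replace (zeta_tsum_conv 0) with 0 by (symmetry; exact (sum_n_m_zero _ 1 0 Nat.lt_0_1)).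
    change (@plus R_AbelianMonoid) with Rplus.
    eq_in_R. ring.
Qed.

(** * Direct evaluation of the symmetric sums, and conclusion *)

Lemma is_lim_symsum_Psi_values (q : nat) : (1 < q)%nat ->
  is_lim_seq (symsum (fun s => Psi s / s ^ q))
    ((1 + (-1) ^ q) * ttilde [q; 1%nat] + ttilde [(q + 1)%nat]
     - 2 * ln 2 * (1 + (-1) ^ q) * ttilde [q]).
Proof.
  intros Hq. rewrite ttilde_arg1, !ttilde_depth1.
  pose proof (Series_correct _ (ex_series_h q Hq)) as H1.
  pose proof (Series_correct _ (ex_series_half_int (q + 1) ltac:(lia))) as H2.
  pose proof (Series_correct _ (ex_series_half_int q Hq)) as H3.
  apply (is_series_Rscal (1 + (-1) ^ q)) in H1.
  apply (is_series_Rscal (- (2 * ln 2 * (1 + (-1) ^ q)))) in H3.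
  pose proof (is_series_Rplus _ _ _ _ (is_series_Rplus _ _ _ _ H1 H2) H3) as H.
  match goal with |- is_lim_seq _ (Finite ?x) =>
    match type of H with is_series _ ?y => replace x with y by ring end end.
  refine (is_lim_seq_ext _ _ (Finite _) _ H); intros N. apply sum_n_ext; intros n.
  eq_in_R.
  rewrite Psi_half_int, Psi_neg_half_int, h_S. unfold Rdiv. rewrite inv_pow_opp.
  pose proof (half_int_S_neq0 n) as Ha.
  rewrite pow_add, pow_1. field. split; [now apply pow_nonzero | exact Ha].
Qed.

(** The pair at a, - a is (h + 1/a - 2 log 2)^2 + (-1)^q (h - 2 log 2)^2 over a^q, expanded into six
    convergent series. *)
Lemma is_lim_symsum_Psi_sqr_values (q : nat) : (1 < q)%nat ->
  is_lim_seq (symsum (fun s => Psi s * Psi s / s ^ q))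
    ((1 + (-1) ^ q) * T11 q + 2 * ttilde [(q + 1)%nat; 1%nat] + ttilde [(q + 2)%nat]
     - 4 * ln 2 * ((1 + (-1) ^ q) * ttilde [q; 1%nat] + ttilde [(q + 1)%nat])
     + 4 * ln 2 ^ 2 * (1 + (-1) ^ q) * ttilde [q]).
Proof.
  intros Hq. rewrite !ttilde_arg1, !ttilde_depth1. unfold T11.
  pose proof (Series_correct _ (ex_series_h_sqr q Hq)) as H0.
  pose proof (Series_correct _ (ex_series_h q Hq)) as H1.
  pose proof (Series_correct _ (ex_series_h (q + 1) ltac:(lia))) as H2.
  pose proof (Series_correct _ (ex_series_half_int q Hq)) as H3.
  pose proof (Series_correct _ (ex_series_half_int (q + 1) ltac:(lia))) as H4.
  pose proof (Series_correct _ (ex_series_half_int (q + 2) ltac:(lia))) as H5.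
  apply (is_series_Rscal (1 + (-1) ^ q)) in H0.
  apply (is_series_Rscal (- (4 * ln 2 * (1 + (-1) ^ q)))) in H1.
  apply (is_series_Rscal 2) in H2.
  apply (is_series_Rscal (4 * ln 2 ^ 2 * (1 + (-1) ^ q))) in H3.
  apply (is_series_Rscal (- (4 * ln 2))) in H4.
  pose proof (is_series_Rplus _ _ _ _ H0 (is_series_Rplus _ _ _ _ H1
    (is_series_Rplus _ _ _ _ H2 (is_series_Rplus _ _ _ _ H3
      (is_series_Rplus _ _ _ _ H4 H5))))) as H.
  match goal with |- is_lim_seq _ (Finite ?x) =>
    match type of H with is_series _ ?y => replace x with y by ring end end.
  refine (is_lim_seq_ext _ _ (Finite _) _ H); intros N. apply sum_n_ext; intros n.
  eq_in_R.
  rewrite Psi_half_int, Psi_neg_half_int, h_S. unfold Rdiv. rewrite inv_pow_opp.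
  pose proof (half_int_S_neq0 n) as Ha.
  rewrite !pow_add, pow_1. field. split; [now apply pow_nonzero | exact Ha].
Qed.

Lemma sum_zeta_Psi_sum (q : nat) : (1 < q)%nat ->
  sum_n_m (fun i => zeta (i + 1) * Psi_sum (q - i)) 1 (q - 1)
  = zeta_tsum_conv (q + 1) - sum_n_m (fun i => zeta (i + 1) * zeta_tsum_conv (q - i)) 1 (q - 1) :> R.
Proof.
  intros Hq.
  rewrite (sum_n_m_ext_loc _ (fun i => plus (zeta (i + 1) * tsum (q + 1 - i))
                                (-1 * (zeta (i + 1) * zeta_tsum_conv (q - i))))).
  2:{ intros i Hi. unfold Psi_sum. replace (q + 1 - i)%nat with (q - i + 1)%nat by lia.
      change (@plus R_AbelianMonoid) with Rplus.
      eq_in_R. ring. }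
  rewrite sum_n_m_plus, sum_n_m_Rscal. change (@plus R_AbelianMonoid) with Rplus.
  (* [zeta_tsum_conv (q + 1)] has one more term, i = q, and it vanishes because [tsum 1] = 0. *)
  unfold zeta_tsum_conv at 2. replace (q + 1 - 1)%nat with (S (q - 1)) by lia.
  rewrite sum_n_Sm by lia. change (@plus R_AbelianMonoid) with Rplus.
  replace (q + 1 - S (q - 1))%nat with 1%nat by lia.
  unfold tsum at 3. simpl pow. ring.
Qed.

Theorem theorem2p5 (q : nat) (hq : (1 < q)%nat) :
  (1 + (-1) ^ q) * T11 q =
    PI ^ 2 * zeta q
    + (-1) ^ q * ttilde [(q + 2)%nat]
    + (1 - (-1) ^ q) * 4 * ln 2 * ttilde [(q + 1)%nat]
    - 2 * ttilde [(q + 1)%nat; 1%nat]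
    + (1 + (-1) ^ q) * 4 * ln 2 ^ 2 * ttilde [q]
    - 4 * sum2 (q + 1) (fun k1 k2 =>
            ttilde [(2 * k1)%nat] * zeta (k2 + 1))
    - 8 * ln 2 * sum2 q (fun k1 k2 =>
            ttilde [(2 * k1)%nat] * zeta (k2 + 1))
    + 2 * sum3 q (fun k1 k2 k3 =>
            ttilde [(2 * k1)%nat] * zeta (k2 + 1) * zeta (k3 + 1)).
Proof.
  (* Equating the two limits for the weight 1 expresses the combination with [ttilde [q; 1]] that
     occurs, times 4 log 2, in the limit for [Psi ^ 2]. *)
  assert (Hlin : (1 + (-1) ^ q) * ttilde [q; 1%nat] + ttilde [(q + 1)%nat]
                 - 2 * ln 2 * (1 + (-1) ^ q) * ttilde [q]
                 = (1 - (-1) ^ q) * ttilde [(q + 1)%nat] - zeta_tsum_conv q).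
  { pose proof (is_lim_seq_unique _ _ (is_lim_symsum_Psi_values q hq)) as H1.
    pose proof (is_lim_seq_unique _ _ (is_lim_symsum_Psi q hq)) as H2.
    rewrite H1 in H2. apply Rbar_finite_eq in H2. rewrite H2. unfold Psi_sum, tsum.
    rewrite pow_add, pow_1. ring. }
  pose proof (is_lim_seq_unique _ _ (is_lim_symsum_Psi_sqr_values q hq)) as H1.
  pose proof (is_lim_seq_unique _ _ (is_lim_symsum_Psi_sqr q hq)) as H2.
  rewrite H1 in H2. apply Rbar_finite_eq in H2 as Hsqr. clear H1 H2.
  rewrite (sum_zeta_Psi_sum q hq), ttilde_2, <- sum3_zeta_tsum in Hsqr by lia.
  unfold Psi_sum, tsum in Hsqr. replace (q + 1 + 1)%nat with (q + 2)%nat in Hsqr by lia.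
  rewrite pow_add in Hsqr. replace ((-1) ^ 2) with 1 in Hsqr by ring.
  (* [zeta_tsum_conv (q + 1)] enters twice, through [Psi_sum (q + 1)] and through the convolution,
     and is twice the double sum: hence the coefficient 4. *)
  rewrite <- (sum2_zeta_tsum (q + 1)) in Hsqr. rewrite <- sum2_zeta_tsum in Hlin.
  set (s2 := sum2 q _) in *. set (s2' := sum2 (q + 1) _) in *. set (s3 := sum3 q _) in *.
  set (E := (-1) ^ q) in *.
  (* Multiplied by 4 log 2 beforehand, the linear relation combines with [Hsqr] by linear arithmetic
     alone. *)
  enough (Hl : 4 * ln 2 * ((1 + E) * ttilde [q; 1%nat] + ttilde [(q + 1)%nat]
                 - 2 * ln 2 * (1 + E) * ttilde [q])
               = 4 * ln 2 * ((1 - E) * ttilde [(q + 1)%nat] - 2 * s2)) by lra.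
  now rewrite Hlin.
Qed.
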